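(* Let $A$ be an $n$-LNakayama algebra and let $D$ be its Dyck path (of semilength $n-1$). Let $\widehat D$ be the lattice path obtained from $D$ by adding a horizontal step from $(0,-1)$ to $(0,0)$ at the beginning and a vertical step from $(n-1,n-1)$ to $(n,n-1)$ at the end. Then for $0\le i\le n-2$: (1) $S_i$ is $1$-regular if and only if $\widehat D$ has a double rise whose midpoint has $y$-coordinate $i$ and a double fall whose midpoint has $x$-coordinate $i+1$; (2) $S_i$ is $2$-regular if and only if $\widehat D$ has a vertical step with final point $(i+1,i+1)$, a double rise whose midpoint has $y$-coordinate $i$, and a double fall whose midpoint has $x$-coordinate $i+2$.
   Context: Fix a field $\mathbb{F}$. An $n$-LNakayama algebra is $A=\mathbb{F}Q/I$ with $Q$ the linear quiver $0\to1\to\cdots\to n-1$ and $I$ admissible ($J^m\subseteq I\subseteq J^2$ for some $m\ge2$, $J$ the arrow ideal). Modules are finite-dimensional right modules; $S_i$ is the simple module at vertex $i$; Kupisch series $c_i=\dim_{\mathbb{F}} e_iA$ ($e_i$ the idempotent at $i$), so $c_{n-1}=1$, $c_i\ge2$ for $i<n-1$ and $c_{i+1}+1\ge c_i$. A simple module $S$ is $k$-regular if $\operatorname{pd}(S)=k$, $\operatorname{Ext}^i_A(S,A)=0$ for $0\le i<k$ and $\dim_{\mathbb{F}}\operatorname{Ext}^k_A(S,A)=1$. Lattice paths use horizontal steps $(x,y)\to(x,y+1)$ and vertical steps $(x,y)\to(x+1,y)$. A Dyck path of semilength $N$ is such a path from $(0,0)$ to $(N,N)$ staying in the region $y\ge x$.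 Its area sequence is $[c_0,\dots,c_N]$ with $c_k=h_k-k+1$, where $h_k$ is the largest $y$ with $(k,y)$ on the path. The Dyck path of an $n$-LNakayama algebra is the unique Dyck path of semilength $n-1$ whose area sequence equals the Kupisch series of $A$. A double rise with midpoint $(x,y)$ is a pair of consecutive horizontal steps $(x,y-1)\to(x,y)\to(x,y+1)$ of the path; a double fall with midpoint $(x,y)$ is a pair of consecutive vertical steps $(x-1,y)\to(x,y)\to(x+1,y)$. *)

(* Defs.v *)
From HB Require Import structures.
From mathcomp Require Import all_boot all_order all_algebra all_field.

Set Implicit Arguments.
Unset Strict Implicit.
Unset Printing Implicit Defensive.

Import Order.TTheory GRing.Theory Num.Theory.
Local Open Scope ring_scope.

(* For i <= j the quiver has exactly one path i -> i+1 -> ... -> j, encoded by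
   its source and target; it is the trivial path when i = j. *)
Definition lpath (n : nat) : Type := {p : 'I_n * 'I_n | (p.1 <= p.2)%N}.

HB.instance Definition _ n := Finite.copy (lpath n)
  {p : 'I_n * 'I_n | (p.1 <= p.2)%N}.

Definition src n (q : lpath n) : 'I_n := (sval q).1.
Definition tgt n (q : lpath n) : 'I_n := (sval q).2.
Definition plen n (q : lpath n) : nat := tgt q - src q.

Definition tpath n (i : 'I_n) : lpath n := exist _ (i, i) (leqnn i).

Lemma lpath_eq n (q r : lpath n) : src q = src r -> tgt q = tgt r -> q = r.
Proof.
case: q r => [[i j] qP] [[k l] rP]; rewrite /src /tgt /= => ik jl.
by apply: val_inj => /=; rewrite ik jl.
Qed.

(* q is the concatenation "first r, then s"; with this order right modules are
   covariant representations of the quiver. *)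
Definition is_concat n (r s q : lpath n) : bool :=
  [&& tgt r == src s, src q == src r & tgt q == tgt s].

(* x : pathalg F n is the linear combination \sum_q x(q) q of paths. *)
Definition pathalg (F : fieldType) (n : nat) : Type := {ffun lpath n -> F^o}.

HB.instance Definition _ F n :=
  Vector.copy (pathalg F n) {ffun lpath n -> F^o}.

Section PathAlgebra.
Variables (F : fieldType) (n : nat).
Implicit Types x y z : pathalg F n.

Definition coefq x (q : lpath n) : F := x q.

Definition pelt (q : lpath n) : pathalg F n := [ffun r => (r == q)%:R].

Definition pone : pathalg F n := \sum_(i < n) pelt (tpath i).

Definition pmul x y : pathalg F n :=
  [ffun q => \sum_(r : lpath n) \sum_(s : lpath n | is_concat r s q)
               coefq x r * coefq y s].

(* Auxiliary embedding into square matrices, used to derive the ring axioms. *)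
Let toM x : 'M[F]_n :=
  \matrix_(i, j) if insub (i, j) is Some q then coefq x q else 0.

Let toM_path x q : toM x (src q) (tgt q) = coefq x q.
Proof.
rewrite mxE; have -> : (src q, tgt q) = sval q by rewrite /src /tgt; case: (sval q).
by rewrite (valK (q : {p : 'I_n * 'I_n | (p.1 <= p.2)%N})).
Qed.

Let toM_out x (i j : 'I_n) : (j < i)%N -> toM x i j = 0.
Proof. by move=> ltji; rewrite mxE insubN //= -ltnNge. Qed.

Let toM_inj : injective toM.
Proof. by move=> x y eqM; apply/ffunP => q; rewrite -!/(coefq _ q) -!toM_path eqM. Qed.

Let lpathP (i j : 'I_n) : (i <= j)%N -> {q : lpath n | src q = i & tgt q = j}.
Proof. by move=> le_ij; exists (exist _ (i, j) le_ij). Qed.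

Let toMM x y : toM (pmul x y) = toM x *m toM y.
Proof.
apply/matrixP => i j; rewrite [RHS]mxE.
have [le_ij|lt_ji] := leqP i j; last first.
  rewrite toM_out // big1 // => k _.
  have [le_ik|lt_ki] := leqP i k; last by rewrite toM_out ?mul0r.
  by rewrite [toM y _ _]toM_out ?mulr0 // (leq_trans lt_ji).
have [q <- <-] := lpathP le_ij; rewrite toM_path /coefq ffunE.
rewrite (partition_big (@tgt n) xpredT) //=; apply: eq_bigr => k _.
have [lt_qk|le_qk] := ltnP k (src q).
  rewrite toM_out // mul0r big1 // => r /eqP tr; rewrite big1 // => s.
  case/and3P=> _ /eqP sq _; have := svalP r; rewrite -/(src r) -/(tgt r) tr -sq.
  by rewrite leqNgt lt_qk.
have [lt_kq|le_kq] := ltnP (tgt q) k.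
  rewrite [toM y _ _]toM_out // mulr0 big1 // => r /eqP tr; rewrite big1 // => s.
  case/and3P=> /eqP rs _ /eqP tq; have := svalP s; rewrite -/(src s) -/(tgt s).
  by rewrite -rs tr -tq leqNgt lt_kq.
have [r0 sr0 tr0] := lpathP le_qk; have [s0 ss0 ts0] := lpathP le_kq.
rewrite (bigD1 r0) ?tr0 //= [X in _ + X]big1 ?addr0; last first.
  move=> r /andP[/eqP tr ne]; rewrite big1 // => s /and3P[_ /eqP sq _].
  by case/eqP: ne; apply: lpath_eq; rewrite ?sr0 ?tr0.
rewrite (bigD1 s0) /=; last by rewrite /is_concat tr0 ss0 sr0 ts0 !eqxx.
rewrite [X in _ + X]big1 ?addr0; last first.
  move=> s /andP[/and3P[/eqP rs _ /eqP tq] ne].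
  by case/eqP: ne; apply: lpath_eq; rewrite ?ss0 ?ts0 -?rs.
by rewrite -toM_path -[in X in _ * X]toM_path sr0 tr0 ss0 ts0.
Qed.

Let toMD x y : toM (x + y) = toM x + toM y.
Proof.
apply/matrixP => i j; rewrite !mxE; case: insubP => [q _ _|]; rewrite ?addr0 //.
by rewrite /coefq ffunE.
Qed.

Let toM1 : toM pone = 1%:M.
Proof.
apply/matrixP => i j; rewrite !mxE; case: insubP => [q _ qE|]; last first.
  by case: eqP => [->|//]; rewrite leqnn.
rewrite /coefq sum_ffunE; under eq_bigr => k _ do rewrite ffunE.
have [eqij|ne_ij] := eqVneq i j; last first.
  rewrite big1 // => k _; case: eqP => // qk.
  by move: qE ne_ij; rewrite qk /= => -[-> ->]; rewrite eqxx.
have qi : q = tpath i by apply: val_inj; rewrite /= qE eqij.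
rewrite (bigD1 i) //= qi eqxx big1 ?addr0 // => k ne_ki.
by case: eqP => // -[] /(congr1 val)/= /val_inj ki; rewrite ki eqxx in ne_ki.
Qed.

Fact pmulA : associative pmul.
Proof. by move=> x y z; apply: toM_inj; rewrite !toMM mulmxA. Qed.
Fact pmul1x : left_id pone pmul.
Proof. by move=> x; apply: toM_inj; rewrite toMM toM1 mul1mx. Qed.
Fact pmulx1 : right_id pone pmul.
Proof. by move=> x; apply: toM_inj; rewrite toMM toM1 mulmx1. Qed.
Fact pmulDl : left_distributive pmul +%R.
Proof. by move=> x y z; apply: toM_inj; rewrite !(toMM, toMD) mulmxDl. Qed.
Fact pmulDr : right_distributive pmul +%R.
Proof. by move=> x y z; apply: toM_inj; rewrite !(toMM, toMD) mulmxDr. Qed.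

HB.instance Definition _ := GRing.Zmodule_isPzRing.Build (pathalg F n)
  pmulA pmul1x pmulx1 pmulDl pmulDr.

End PathAlgebra.

Section PathAlgebraStructure.
Variables (F : fieldType) (N : nat).
Implicit Types x y : pathalg F N.+1.

Lemma coef_tpathM (i : 'I_N.+1) x y :
  coefq (x * y) (tpath i) = coefq x (tpath i) * coefq y (tpath i).
Proof.
rewrite {1}/coefq ffunE (bigD1 (tpath i)) //= [X in _ + X]big1 ?addr0.
  rewrite (bigD1 (tpath i)) /=; last by rewrite /is_concat !eqxx.
  rewrite big1 ?addr0 // => s /andP[/and3P[/eqP rs _ /eqP tq] ne].
  by case/eqP: ne; apply: lpath_eq; rewrite -?rs -?tq.
move=> r ne; rewrite big1 // => s /and3P[/eqP rs /eqP sq /eqP tq].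
case/eqP: ne; apply: lpath_eq => //; apply: val_inj; apply/eqP.
have := svalP s; rewrite -/(src s) -/(tgt s) -tq -rs => le_ri.
have := svalP r; rewrite -/(src r) -/(tgt r) -sq => le_ir.
by rewrite eqn_leq le_ri le_ir.
Qed.

Lemma coef_tpath1 (i : 'I_N.+1) : coefq (1 : pathalg F N.+1) (tpath i) = 1.
Proof.
rewrite /coefq sum_ffunE (bigD1 i) //= ffunE eqxx big1 ?addr0 // => k ne.
by rewrite ffunE; case: eqP => // -[] ki _; rewrite ki eqxx in ne.
Qed.

Fact pathalg_nz : (1 : pathalg F N.+1) != 0.
Proof.
apply/eqP => /(congr1 (fun x => coefq x (tpath ord0))).
by rewrite coef_tpath1 /coefq ffunE => /eqP; rewrite oner_eq0.
Qed.

HB.instance Definition _ :=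
  GRing.PzSemiRing_isNonZero.Build (pathalg F N.+1) pathalg_nz.

Fact pscaleAl (a : F) x y : a *: (x * y) = a *: x * y.
Proof.
apply/ffunP => q; rewrite !ffunE [LHS]mulr_sumr; apply: eq_bigr => r _.
by rewrite mulr_sumr; apply: eq_bigr => s _; rewrite /coefq ffunE mulrA.
Qed.

HB.instance Definition _ :=
  GRing.Lmodule_isLalgebra.Build F (pathalg F N.+1) pscaleAl.

Fact pscaleAr (a : F) x y : a *: (x * y) = x * (a *: y).
Proof.
apply/ffunP => q; rewrite !ffunE [LHS]mulr_sumr; apply: eq_bigr => r _.
by rewrite mulr_sumr; apply: eq_bigr => s _; rewrite /coefq ffunE mulrCA.
Qed.

HB.instance Definition _ :=
  GRing.Lalgebra_isAlgebra.Build F (pathalg F N.+1) pscaleAr.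

HB.instance Definition _ := Algebra_isFalgebra.Build F (pathalg F N.+1).

End PathAlgebraStructure.

Section LNakayama.
Variables (F : fieldType) (N : nat).

(* The two-sided ideal generated by the arrows, i.e. the paths of length 1. *)
Definition arrow_ideal : {vspace pathalg F N.+1} :=
  ({: pathalg F N.+1}
     * <<[seq pelt F q | q in [pred q : lpath N.+1 | plen q == 1%N]]>>
     * {: pathalg F N.+1})%VS.

Definition admissible (I : {vspace pathalg F N.+1}) : Prop :=
  (exists2 m, (2 <= m)%N & (arrow_ideal ^+ m <= I)%VS)
  /\ (I <= arrow_ideal ^+ 2)%VS.

(* An n-LNakayama algebra with n = N.+1: an algebra A together with a
   presentation A = FQ/I, i.e. a surjective algebra morphism from the path
   algebra FQ whose kernel I is an admissible ideal. *)
Record LNakayama := MkLNakayama {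
  lnak_alg :> falgType F;
  lnak_pi : 'AHom(pathalg F N.+1, lnak_alg);
  lnak_surj : limg lnak_pi = fullv;
  lnak_adm : admissible (lker lnak_pi) }.

Variable A : LNakayama.

Definition idem (i : 'I_N.+1) : A := lnak_pi A (pelt F (tpath i)).

Definition kupisch (i : 'I_N.+1) : nat := \dim (<[idem i]> * {: A})%VS.

End LNakayama.

Section Modules.
Variables (F : fieldType) (A : falgType F).

(* The product v . a of v : M and a : A is [ract M a v]. *)
Record rmod := RMod {
  rmod_sort :> vectType F;
  ract : 'Hom(A, 'End(rmod_sort));
  ract1 : ract 1 = \1%VF;
  ractM : forall a b, ract (a * b) = (ract b \o ract a)%VF }.

Definition rmod_hom (M N : rmod) (f : 'Hom(M, N)) : Prop :=
  forall (v : M) (a : A), f (ract M a v) = ract N a (f v).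

(* Projectivity in the category of finite-dimensional right A-modules. *)
Definition projective (P : rmod) : Prop :=
  forall (M N : rmod) (g : 'Hom(M, N)) (f : 'Hom(P, N)),
    rmod_hom g -> limg g = fullv -> rmod_hom f ->
    exists2 h : 'Hom(P, M), rmod_hom h & (g \o h)%VF = f.

Record proj_res (M : rmod) := ProjRes {
  res_mod :> nat -> rmod;
  res_d : forall k, 'Hom(res_mod k.+1, res_mod k);
  res_eps : 'Hom(res_mod 0, M);
  res_proj : forall k, projective (res_mod k);
  res_d_hom : forall k, rmod_hom (res_d k);
  res_eps_hom : rmod_hom res_eps;
  res_eps_surj : limg res_eps = fullv;
  res_exact0 : limg (res_d 0) = lker res_eps;
  res_exact : forall k, limg (res_d k.+1) = lker (res_d k) }.

Definition pd_le (M : rmod) (k : nat) : Prop :=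
  exists P : proj_res M, forall j, (k < j)%N -> \dim {: P j} = 0%N.

Definition pd_eq (M : rmod) (k : nat) : Prop :=
  pd_le M k /\ (forall j, pd_le M j -> (k <= j)%N).

Definition precomp (U V W : vectType F) (d : 'Hom(U, V)) :
    'Hom('Hom(V, W), 'Hom(U, W)) :=
  linfun (fun f : 'Hom(V, W) => (f \o d)%VF).

Definition postcomp (U V W : vectType F) (d : 'Hom(V, W)) :
    'Hom('Hom(U, V), 'Hom(U, W)) :=
  linfun (fun f : 'Hom(U, V) => (d \o f)%VF).

(* Hom_A(M, N); it suffices to test linearity over a basis of A. *)
Definition HomA (M N : rmod) : {vspace 'Hom(M, N)} :=
  (\bigcap_(i < \dim {: A})
     lker (precomp N (ract M (vbasis {: A})`_i)
           - postcomp M (ract N (vbasis {: A})`_i)))%VS.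

Lemma precompE (U V W : vectType F) (d : 'Hom(U, V)) (f : 'Hom(V, W)) :
  precomp W d f = (f \o d)%VF.
Proof.
have lin : linear (fun f : 'Hom(V, W) => (f \o d)%VF).
  by move=> a g h; rewrite comp_lfunDl -comp_lfunZl.
pose L := GRing.isLinear.Build _ _ _ _ _ lin.
pose h : {linear 'Hom(V, W) -> 'Hom(U, W)} := HB.pack (fun f : 'Hom(V, W) => (f \o d)%VF) L.
exact: (lfunE h).
Qed.

Lemma postcompE (U V W : vectType F) (d : 'Hom(V, W)) (f : 'Hom(U, V)) :
  postcomp U d f = (d \o f)%VF.
Proof.
have lin : linear (fun f : 'Hom(U, V) => (d \o f)%VF).
  by move=> a g h; rewrite comp_lfunDr -comp_lfunZr.
pose L := GRing.isLinear.Build _ _ _ _ _ lin.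
pose h : {linear 'Hom(U, V) -> 'Hom(U, W)} := HB.pack (fun f : 'Hom(U, V) => (d \o f)%VF) L.
exact: (lfunE h).
Qed.

Lemma HomAP (M N : rmod) (f : 'Hom(M, N)) : f \in HomA M N <-> rmod_hom f.
Proof.
split=> [fH v a|fH].
  have fb (i : 'I_(\dim {: A})) : (f \o ract M (vbasis {: A})`_i)%VF
      = (ract N (vbasis {: A})`_i \o f)%VF.
    move: fH; rewrite memvE => /subv_bigcapP/(_ i isT); rewrite -memvE memv_ker.
    by rewrite !lfunE /= lfunE /= precompE postcompE subr_eq0 => /eqP.
  rewrite (coord_vbasis (memvf a)) !linear_sum /= !sum_lfunE linear_sum /=.
  apply: eq_bigr => i _; rewrite !linearZ /= !scale_lfunE linearZ /=.
  by rewrite -!comp_lfunE fb.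
rewrite memvE; apply/subv_bigcapP => i _; rewrite -memvE memv_ker.
rewrite !lfunE /= lfunE /= precompE postcompE subr_eq0.
by apply/eqP/lfunP => v; rewrite !comp_lfunE.
Qed.

Section Ext.
Variables (M : rmod) (P : proj_res M) (N : rmod).

(* The complex 0 -> Hom_A(P_0, N) -> Hom_A(P_1, N) -> ... *)
Definition cocycles (k : nat) : {vspace 'Hom(P k, N)} :=
  (HomA (P k) N :&: lker (precomp N (res_d P k)))%VS.

Definition coboundaries (k : nat) : {vspace 'Hom(P k, N)} :=
  match k with
  | 0 => 0%VS
  | j.+1 => (precomp N (res_d P j) @: HomA (P j) N)%VS
  end.

Lemma cocyclesP k f :
  f \in cocycles k <-> rmod_hom f /\ (f \o res_d P k)%VF = 0.
Proof.
rewrite memv_cap memv_ker precompE; split=> [/andP[/HomAP ? /eqP]|[? ->]] //.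
by rewrite eqxx andbT; apply/HomAP.
Qed.

Lemma coboundariesSP k f :
  f \in coboundaries k.+1
  <-> exists2 g : 'Hom(P k, N), rmod_hom g & f = (g \o res_d P k)%VF.
Proof.
split=> [/memv_imgP[g /HomAP gH ->]|[g /HomAP gH ->]].
  by exists g; rewrite ?precompE.
by rewrite -precompE memv_img.
Qed.

Lemma coboundaries_sub k : (coboundaries k <= cocycles k)%VS.
Proof.
case: k => [|k]; first exact: sub0v.
apply/subvP => f /coboundariesSP[g gH ->]; apply/cocyclesP; split.
  by move=> v a; rewrite !comp_lfunE /= res_d_hom gH.
rewrite -comp_lfunA; have -> : (res_d P k \o res_d P k.+1)%VF = 0.
  apply/lfunP => v; rewrite comp_lfunE zero_lfunE; apply/eqP.
  by rewrite -memv_ker -res_exact memv_img ?memvf.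
exact: comp_lfun0r.
Qed.

(* The dimension of the k-th cohomology space cocycles / coboundaries. *)
Definition cohom_dim (k : nat) : nat :=
  (\dim (cocycles k) - \dim (coboundaries k))%N.

End Ext.

(* dim_F Ext^k_A(M, N) = d, where Ext^k_A(M, N) is the k-th cohomology of
   Hom_A(P, N) for a projective resolution P of M; by the comparison theorem
   the value does not depend on the choice of P. *)
Definition Ext_dim (M N : rmod) (k d : nat) : Prop :=
  exists P : proj_res M, cohom_dim P N k = d.

Fact ract_reg1 : (linfun (@amulr F A)) 1 = \1%VF.
Proof. by rewrite lfunE /=; apply/lfunP => v; rewrite !lfunE /= mulr1. Qed.

Fact ract_regM a b :
  (linfun (@amulr F A)) (a * b)
  = (linfun (@amulr F A) b \o linfun (@amulr F A) a)%VF.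
Proof.
by rewrite !lfunE /=; apply/lfunP => v; rewrite comp_lfunE !lfunE /= mulrA.
Qed.

Definition reg_mod : rmod := RMod ract_reg1 ract_regM.

Definition k_regular (S : rmod) (k : nat) : Prop :=
  [/\ pd_eq S k,
      forall i, (i < k)%N -> Ext_dim S reg_mod i 0
    & Ext_dim S reg_mod k 1].

Definition simple_mod (S : rmod) : Prop :=
  \dim {: S} <> 0%N /\
  forall U : {vspace S}, (forall a, (ract S a @: U <= U)%VS) ->
    U = 0%VS \/ U = fullv.

End Modules.

Section Simple.
Variables (F : fieldType) (N : nat) (A : LNakayama F N) (i : 'I_N.+1).

Definition coef_scalar (x : pathalg F N.+1) : 'End(F^o) :=
  (coefq x (tpath i)) *: \1%VF.

Fact coef_scalar_lin : linear coef_scalar.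
Proof.
by move=> a x y; rewrite /coef_scalar /coefq !ffunE scalerDl scalerA.
Qed.

HB.instance Definition _ :=
  GRing.isLinear.Build _ _ _ _ coef_scalar coef_scalar_lin.

(* An element a of A acts on S_i = F as multiplication by the coefficient of
   the trivial path e_i in a preimage of a (all preimages have the same one,
   as the kernel lies in the square of the arrow ideal). *)
Definition ract_simple : 'Hom(A, 'End(F^o)) :=
  (linfun coef_scalar \o (lnak_pi A)^-1)%VF.

Let coef_arrow_ideal x : x \in arrow_ideal F N -> coefq x (tpath i) = 0.
Proof.
have mem y : (y \in lker (linfun coef_scalar)) = (coefq y (tpath i) == 0).
  rewrite memv_ker lfunE /= /coef_scalar scaler_eq0.
  by rewrite (negPf (lfun1_neq0 _)) ?orbF // dimvf.
suff sJ : (arrow_ideal F N <= lker (linfun coef_scalar))%VS.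
  by move/(subvP sJ); rewrite mem => /eqP.
apply/prodvP => y z yJ _; rewrite mem coef_tpathM.
suff /eqP-> : coefq y (tpath i) == 0 by rewrite mul0r.
rewrite -mem; move: y yJ; apply/subvP/prodvP => y' z' _ z'J.
rewrite mem coef_tpathM.
suff /eqP-> : coefq z' (tpath i) == 0 by rewrite mulr0.
rewrite -mem; move: z' z'J; apply/subvP/span_subvP => _ /imageP[q q1 ->].
rewrite mem /coefq ffunE.
case: (tpath i =P q) => [qi|_]; last by rewrite eqxx.
by move: q1; rewrite inE -qi /plen subnn.
Qed.

Lemma ract_simpleE x :
  ract_simple (lnak_pi A x) = coefq x (tpath i) *: \1%VF.
Proof.
rewrite comp_lfunE lfunE /= /coef_scalar; set y := (_^-1)%VF _.
congr (_ *: _); have /(subvP (lnak_adm A).2) : y - x \in lker (lnak_pi A).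
  by rewrite memv_ker linearB /= limg_lfunVK ?subrr ?memv_img ?memvf.
move=> yx; have : y - x \in arrow_ideal F N.
  apply: subvP yx; rewrite expv2; apply/prodvP => u v uJ vJ.
  rewrite /arrow_ideal in uJ *.
  have := memv_mul uJ (memvf v); rewrite -prodvA.
  by apply/subvP; rewrite prodvS ?subvf.
move/coef_arrow_ideal; rewrite /coefq !ffunE => /eqP.
by rewrite subr_eq0 => /eqP.
Qed.

Let lnak_lift a : exists x, lnak_pi A x = a.
Proof.
have : a \in limg (lnak_pi A) by rewrite lnak_surj memvf.
by case/memv_imgP => x _ ->; exists x.
Qed.

Fact ract_simple1 : ract_simple 1 = \1%VF.
Proof. by rewrite -(rmorph1 (lnak_pi A)) ract_simpleE coef_tpath1 scale1r. Qed.

Fact ract_simpleM a b :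
  ract_simple (a * b) = (ract_simple b \o ract_simple a)%VF.
Proof.
have [[x <-] [y <-]] := (lnak_lift a, lnak_lift b).
rewrite -rmorphM !ract_simpleE coef_tpathM -comp_lfunZl comp_lfun1l scalerA.
by rewrite mulrC.
Qed.

Definition simple_at : rmod A := RMod ract_simple1 ract_simpleM.

Lemma simple_at_simple : simple_mod simple_at.
Proof.
split; first by rewrite dimvf.
move=> U _; have : (\dim U <= 1)%N by rewrite -[1%N](dimvf F^o) dimvS ?subvf.
rewrite leq_eqVlt ltnS leqn0 dimv_eq0 => /orP[/eqP U1|/eqP]; last by left.
by right; apply/eqP; rewrite eqEdim subvf /= U1 dimvf.
Qed.

Lemma simple_at_idem j (v : simple_at) :
  ract simple_at (idem A j) v = (i == j)%:R *: v.
Proof.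
rewrite ract_simpleE scale_lfunE id_lfunE /coefq ffunE; congr (_%:R *: _).
by congr nat_of_bool; apply/eqP/eqP => [[]|->].
Qed.

End Simple.

(* A lattice path is the sequence of the points (x, y) it visits; horizontal
   steps increase y and vertical steps increase x. *)
Definition point : Type := (int * int)%type.

Definition hstep (p q : point) : bool := q == (p.1, p.2 + 1).
Definition vstep (p q : point) : bool := q == (p.1 + 1, p.2).

Definition lattice_path (s : seq point) : bool :=
  sorted (fun p q => hstep p q || vstep p q) s.

Definition is_dyck (N : nat) (s : seq point) : Prop :=
  exists t, [/\ s = (0, 0) :: t, last (0, 0) t = (N%:Z, N%:Z),
                lattice_path s & all (fun p : point => p.1 <= p.2) s].

(* The largest y with (k, y) on the path; the default 0 is harmless for Dyck
   paths, all of whose points have y >= 0. *)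
Definition height (s : seq point) (k : nat) : int :=
  \big[Num.max/0]_(p <- s | p.1 == k%:Z) p.2.

Definition area (s : seq point) (k : nat) : int := height s k - k%:Z + 1.

Definition is_dyck_path_of (F : fieldType) (N : nat) (A : LNakayama F N)
    (D : seq point) : Prop :=
  is_dyck N D /\ forall k : 'I_N.+1, area D k = (kupisch A k)%:Z.

Definition extend_path (N : nat) (D : seq point) : seq point :=
  (0, -1) :: rcons D (N.+1%:Z, N%:Z).

Definition double_rise (s : seq point) (x y : int) : bool :=
  infix [:: (x, y - 1); (x, y); (x, y + 1)] s.

Definition double_fall (s : seq point) (x y : int) : bool :=
  infix [:: (x - 1, y); (x, y); (x + 1, y)] s.

Definition vstep_to (s : seq point) (x y : int) : bool :=
  infix [:: (x - 1, y); (x, y)] s.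

(* Main.v *)
Require Import Defs.
From HB Require Import structures.
From mathcomp Require Import all_boot all_order all_algebra all_field.
From mathcomp Require Import zify.
Import Order.TTheory GRing.Theory Num.Theory.
Local Open Scope ring_scope.

Set Implicit Arguments.
Unset Strict Implicit.
Unset Printing Implicit Defensive.

(** Let h_i = i + c_i - 1, so that the path from i to j is nonzero in A exactly
    when i <= j <= h_i; h is also the height function of the Dyck path. The
    minimal projective resolution of S_i has terms e_a A, where a runs through
    a_0 = i, a_1 = i + 1, a_{k+2} = h_{a_k} + 1, and stops as soon as
    h_{a_k} = h_{a_{k+1}}. By the comparison theorem Ext may be computed with it,
    and Hom_A(e_a A, A) = A e_a has dimension #{j | j <= a <= h_j}. Counting
    dimensions shows that S_i is 1-regular iff i is not a value of h and
    h_i = h_{i+1}, and 2-regular iff i is not a value of h, h_i = i + 1 and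
    h_{i+1} = h_{i+2}. On the extended Dyck path, i is not a value of h iff no
    vertical step has height i, i.e. iff there is a double rise at height i, and
    h_{x-1} = h_x iff there is a double fall in column x. *)

(** * Modules and the comparison theorem *)

(** Chain maps and homotopies are chosen degree by degree, each in terms of the previous one. Over
    choice types [xchoose] picks the successors, so no choice axiom enters. *)
Lemma dependent_choice (T : nat -> choiceType) (G : forall k, pred (T k))
    (R : forall k, T k -> T k.+1 -> bool) (x0 : T 0) :
  G 0 x0 ->
  (forall k x, G k x -> exists y, R k x y && G k.+1 y) ->
  exists s : forall k, T k,
    [/\ s 0 = x0, forall k, G k (s k) & forall k, R k (s k) (s k.+1)].
Proof.
move=> Gx0 step.
pose next k (x : {x : T k | G k x}) : {y : T k.+1 | G k.+1 y} :=
  exist _ (xchoose (step k _ (svalP x)))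
    (proj2 (andP (xchooseP (step k _ (svalP x))))).
pose s := fix s k : {x : T k | G k x} :=
  if k is j.+1 then next j (s j) else exist _ x0 Gx0.
exists (fun k => sval (s k)); split=> // k; first exact: (svalP (s k)).
by have /andP[] := xchooseP (step k _ (svalP (s k))).
Qed.

(** The hypotheses make [f] induce an injection of Z1/B1 into Z2/B2. Instead of forming quotients,
    rank-nullity is applied to [Z1] and to the part of [Z1] sent into [B2]. *)
Lemma dim_subquotient_le (K : fieldType) (U V : vectType K) (f : 'Hom(U, V))
    (Z1 B1 : {vspace U}) (Z2 B2 : {vspace V}) :
  (B1 <= Z1)%VS -> (B2 <= Z2)%VS -> (f @: Z1 <= Z2)%VS ->
  (forall u, u \in Z1 -> f u \in B2 -> u \in B1) ->
  (\dim Z1 - \dim B1 <= \dim Z2 - \dim B2)%N.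
Proof.
move=> sB1 sB2 sZ fB.
have sW : (Z1 :&: f @^-1: B2 <= B1)%VS.
  by apply/subvP => u /memv_capP[uZ]; rewrite -memv_preim; apply: fB.
have kerW : (Z1 :&: f @^-1: B2 :&: lker f = Z1 :&: lker f)%VS.
  rewrite -capvA; congr (_ :&: _)%VS; apply/capv_idPr; apply/subvP => u.
  by rewrite memv_ker -memv_preim => /eqP->; rewrite mem0v.
have imW : (f @: (Z1 :&: f @^-1: B2) = f @: Z1 :&: B2)%VS.
  apply/vspaceP => v; apply/idP/idP.
    case/memv_imgP => u /memv_capP[uZ]; rewrite -memv_preim => fu ->.
    by rewrite memv_cap fu memv_img.
  case/memv_capP => /memv_imgP[u uZ ->] fu.
  by rewrite memv_img // memv_cap uZ -memv_preim.
have := limg_ker_dim f Z1; have := limg_ker_dim f (Z1 :&: f @^-1: B2)%VS.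
rewrite kerW imW; have := dimv_sum_cap (f @: Z1)%VS B2.
have : (\dim (f @: Z1 + B2) <= \dim Z2)%N by rewrite dimvS // subv_add sZ.
have := dimvS sW; have := dimvS sB1; have := dimvS sB2.
lia.
Qed.

Lemma linfun_linearE (K : fieldType) (U V : vectType K) (f : U -> V) u :
  linear f -> linfun f u = f u.
Proof.
move=> lin; pose L := GRing.isLinear.Build _ _ _ _ _ lin.
pose h : {linear U -> V} := HB.pack f L; exact: (lfunE h).
Qed.

Section Modules.
Variables (F : fieldType) (A : falgType F).
Implicit Types M N L : rmod A.

Lemma ract1E M (v : M) : ract M 1 v = v.
Proof. by rewrite ract1 id_lfunE. Qed.

Lemma ractME M a b (v : M) : ract M (a * b) v = ract M b (ract M a v).
Proof. by rewrite ractM comp_lfunE. Qed.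

Lemma ract0l M (v : M) : ract M 0 v = 0.
Proof. by rewrite linear0 zero_lfunE. Qed.

Lemma rmod_hom_id M : rmod_hom (\1%VF : 'Hom(M, M)).
Proof. by move=> v a; rewrite !id_lfunE. Qed.

Lemma rmod_homB M N (f g : 'Hom(M, N)) :
  rmod_hom f -> rmod_hom g -> rmod_hom (f - g).
Proof. by move=> /HomAP fH /HomAP gH; apply/HomAP; rewrite memvB. Qed.

Lemma rmod_hom_comp M N L (f : 'Hom(M, N)) (g : 'Hom(N, L)) :
  rmod_hom f -> rmod_hom g -> rmod_hom (g \o f)%VF.
Proof. by move=> fH gH v a; rewrite !comp_lfunE fH gH. Qed.

Section Submodule.
Variables (M : rmod A) (U : {vspace M}).
Hypothesis Ustable : forall a v, v \in U -> ract M a v \in U.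

Definition ract_sub : 'Hom(A, 'End(subvs_of U)) :=
  (postcomp _ (linfun (vsproj U)) \o precomp _ (linfun (@vsval _ _ U))
    \o ract M)%VF.

Lemma ract_subE a (v : subvs_of U) :
  ract_sub a v = vsproj U (ract M a (vsval v)).
Proof.
by rewrite !comp_lfunE precompE postcompE !comp_lfunE /= !lfunE.
Qed.

Lemma val_ract_sub a (v : subvs_of U) :
  vsval (ract_sub a v) = ract M a (vsval v).
Proof. by rewrite ract_subE vsprojK // Ustable ?subvsP. Qed.

Fact ract_sub1 : ract_sub 1 = \1%VF.
Proof.
by apply/lfunP => v; apply: val_inj; rewrite /= val_ract_sub ract1E id_lfunE.
Qed.

Fact ract_subM a b : ract_sub (a * b) = (ract_sub b \o ract_sub a)%VF.
Proof.
apply/lfunP => v; apply: val_inj.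
by rewrite /= comp_lfunE !val_ract_sub ractME.
Qed.

Definition submod : rmod A := RMod ract_sub1 ract_subM.

Lemma val_ract_submod a (v : submod) :
  vsval (ract submod a v : subvs_of U) = ract M a (vsval (v : subvs_of U)).
Proof. exact: val_ract_sub. Qed.

End Submodule.

(** Since [projective] speaks of surjections only, the target is replaced by the submodule [limg g],
    through which both maps factor. *)
Lemma projective_lift (P M N : rmod A) (g : 'Hom(M, N)) (f : 'Hom(P, N)) :
  projective P -> rmod_hom g -> rmod_hom f -> (limg f <= limg g)%VS ->
  exists2 h : 'Hom(P, M), rmod_hom h & (g \o h)%VF = f.
Proof.
move=> projP gH fH sfg.
have st a v : v \in limg g -> ract N a v \in limg g.
  by case/memv_imgP => u _ ->; rewrite -gH memv_img ?memvf.
pose pi : 'Hom(N, submod st) := linfun (vsproj (limg g)).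
have piK v : v \in limg g -> vsval (pi v : subvs_of _) = v.
  by move=> vg; rewrite /pi lfunE /= vsprojK.
have piH L (k : 'Hom(L, N)) : rmod_hom k -> (limg k <= limg g)%VS ->
    rmod_hom (pi \o k : 'Hom(L, submod st))%VF.
  move=> kH skg v a; rewrite (comp_lfunE _ _ v) comp_lfunE; apply: subvs_inj.
  have kg u : k u \in limg g by rewrite (subvP skg) ?memv_img ?memvf.
  by rewrite [LHS]piK // kH; apply/esym; rewrite [LHS]val_ract_submod piK.
have surj : limg (pi \o g : 'Hom(M, submod st))%VF = fullv.
  apply/eqP; rewrite eqEsubv subvf; apply/subvP => w _.
  have /memv_imgP[u _ wu] := subvsP (w : subvs_of (limg g)).
  suff -> : w = (pi \o g)%VF u by rewrite memv_img ?memvf.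
  by apply: val_inj; rewrite /= comp_lfunE piK ?memv_img ?memvf.
have [h hH hE] := projP _ _ _ _ (piH _ _ gH (subvv _)) surj (piH _ _ fH sfg).
exists h => //; apply/lfunP => v; have := congr1 (fun k : 'Hom(_, _) => k v) hE.
rewrite !comp_lfunE => /(congr1 (fun w : submod st => vsval (w : subvs_of _))).
by rewrite !piK ?memv_img ?memvf // (subvP sfg) ?memv_img ?memvf.
Qed.

Lemma limg_sub_lker (U V W : vectType F) (f : 'Hom(U, V)) (g : 'Hom(V, W)) :
  (limg f <= lker g)%VS <-> (g \o f)%VF = 0.
Proof.
split=> [/subvP s|gf].
  apply/lfunP => v; rewrite comp_lfunE zero_lfunE; apply/eqP.
  by rewrite -memv_ker s ?memv_img ?memvf.
apply/subvP => _ /memv_imgP[u _ ->].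
by rewrite memv_ker -comp_lfunE gf zero_lfunE.
Qed.

Section Comparison.
Variable M : rmod A.
Implicit Types P Q : proj_res M.

Lemma res_dd P k : (res_d P k \o res_d P k.+1)%VF = 0.
Proof. by apply/limg_sub_lker; rewrite res_exact. Qed.

Lemma res_epsd P : (res_eps P \o res_d P 0)%VF = 0.
Proof. by apply/limg_sub_lker; rewrite res_exact0. Qed.

Lemma chain_map_exists P Q :
  exists f : forall k, 'Hom(P k, Q k),
    [/\ forall k, rmod_hom (f k), (res_eps Q \o f 0)%VF = res_eps P
      & forall k, (res_d Q k \o f k.+1)%VF = (f k \o res_d P k)%VF].
Proof.
have sP : (limg (res_eps P) <= limg (res_eps Q))%VS.
  by rewrite (res_eps_surj Q) subvf.
have [f0 f0H f0E] :=
  projective_lift (@res_proj _ _ _ P 0) (@res_eps_hom _ _ _ Q)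
    (@res_eps_hom _ _ _ P) sP.
(* The invariant carries the inclusion of images that lets projectivity lift once more. *)
pose G k : pred 'Hom(P k, Q k) := fun f =>
  (f \in HomA (P k) (Q k)) && (limg (f \o res_d P k) <= limg (res_d Q k))%VS.
pose R k (f : 'Hom(P k, Q k)) (f' : 'Hom(P k.+1, Q k.+1)) :=
  (res_d Q k \o f')%VF == (f \o res_d P k)%VF.
have G0 : G 0 f0.
  apply/andP; split; first exact/HomAP.
  by rewrite res_exact0; apply/limg_sub_lker; rewrite comp_lfunA f0E res_epsd.
have step k f : G k f -> exists f', R k f f' && G k.+1 f'.
  case/andP => /HomAP fH sf.
  have fdH := rmod_hom_comp (@res_d_hom _ _ _ P k) fH.
  have [f' f'H f'E] :=
    projective_lift (@res_proj _ _ _ P k.+1) (@res_d_hom _ _ _ Q k) fdH sf.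
  exists f'; rewrite /R f'E eqxx /=; apply/andP; split; first exact/HomAP.
  rewrite res_exact; apply/limg_sub_lker.
  by rewrite comp_lfunA f'E -comp_lfunA res_dd comp_lfun0r.
have [f [fE fG fR]] := dependent_choice G0 step.
exists f; split=> [k||k]; last exact/eqP/fR.
  by case/andP: (fG k) => /HomAP.
by rewrite fE.
Qed.

Lemma null_homotopy_exists Q (h : forall k, 'Hom(Q k, Q k)) :
  (forall k, rmod_hom (h k)) -> (res_eps Q \o h 0)%VF = 0 ->
  (forall k, (res_d Q k \o h k.+1)%VF = (h k \o res_d Q k)%VF) ->
  exists s : forall k, 'Hom(Q k, Q k.+1),
    [/\ forall k, rmod_hom (s k), h 0 = (res_d Q 0 \o s 0)%VF
      & forall k, h k.+1 = ((res_d Q k.+1 \o s k.+1) + (s k \o res_d Q k))%VF].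
Proof.
move=> hH h0 hd.
have sh : (limg (h 0%N) <= limg (res_d Q 0%N))%VS.
  by rewrite res_exact0; apply/limg_sub_lker.
have [s0 s0H s0E] :=
  projective_lift (@res_proj _ _ _ Q 0) (@res_d_hom _ _ _ Q 0) (hH 0) sh.
(* The invariant says that what remains of [h k.+1] after removing [s \o res_d Q k] is a boundary,
   so the next homotopy component can be lifted. *)
pose G k : pred 'Hom(Q k, Q k.+1) := fun s =>
  (s \in HomA (Q k) (Q k.+1))
  && (limg (h k.+1 - (s \o res_d Q k))%VF <= limg (res_d Q k.+1))%VS.
pose R k (s : 'Hom(Q k, Q k.+1)) (s' : 'Hom(Q k.+1, Q k.+2)) :=
  (res_d Q k.+1 \o s')%VF == (h k.+1 - (s \o res_d Q k))%VF.
have G0 : G 0 s0.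
  apply/andP; split; first exact/HomAP.
  rewrite res_exact; apply/limg_sub_lker.
  by rewrite comp_lfunDr comp_lfunNr hd comp_lfunA s0E subrr.
have step k s : G k s -> exists s', R k s s' && G k.+1 s'.
  case/andP => /HomAP sH ss.
  have tH := rmod_homB (hH k.+1) (rmod_hom_comp (@res_d_hom _ _ _ Q k) sH).
  have [s' s'H s'E] :=
    projective_lift (@res_proj _ _ _ Q k.+1) (@res_d_hom _ _ _ Q k.+1) tH ss.
  exists s'; rewrite /R s'E eqxx /=; apply/andP; split; first exact/HomAP.
  rewrite res_exact; apply/limg_sub_lker.
  rewrite comp_lfunDr comp_lfunNr hd comp_lfunA s'E comp_lfunDl comp_lfunNl.
  by rewrite -(comp_lfunA s) res_dd comp_lfun0r subr0 subrr.
have [s [sE sG sR]] := dependent_choice G0 step.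
exists s; split=> [k||k]; first by case/andP: (sG k) => /HomAP.
  by rewrite sE.
by rewrite (eqP (sR k)) subrK.
Qed.

(** Precomposition with a chain map [f] from P to Q is injective on cohomology: [f \o g] is
    homotopic to the identity of Q, so a cocycle [u] differs from [u \o f \o g] by a coboundary. *)
Lemma cohom_dim_le P Q N k : (cohom_dim Q N k <= cohom_dim P N k)%N.
Proof.
have [f [fH f0 fd]] := chain_map_exists P Q.
have [g [gH g0 gd]] := chain_map_exists Q P.
pose h k := ((f k \o g k) - \1)%VF.
have [||j|s [sH s0 sd]] := null_homotopy_exists (Q := Q) (h := h).
- by move=> j; apply: rmod_homB; [exact: rmod_hom_comp | exact: rmod_hom_id].
- by rewrite comp_lfunDr comp_lfunNr comp_lfunA f0 g0 comp_lfun1r subrr.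
- rewrite comp_lfunDr comp_lfunNr comp_lfunA fd -comp_lfunA gd.
  by rewrite comp_lfunDl comp_lfunNl comp_lfun1l comp_lfun1r comp_lfunA.
have uE j (u : 'Hom(Q j, N)) : u = ((u \o f j \o g j) - (u \o h j))%VF.
  by rewrite comp_lfunDr comp_lfunNr comp_lfunA comp_lfun1r opprB addrC subrK.
apply: (dim_subquotient_le (f := precomp N (f k))).
- exact: coboundaries_sub.
- exact: coboundaries_sub.
- apply/subvP => _ /memv_imgP[u /cocyclesP[uH ud] ->]; apply/cocyclesP.
  rewrite precompE; split; first exact: rmod_hom_comp.
  by rewrite -comp_lfunA -fd comp_lfunA ud comp_lfun0l.
move=> u /cocyclesP[uH ud]; rewrite precompE.
case: k u uH ud => [|k] u uH ud.
  rewrite !memv0 => /eqP uf; rewrite (uE _ u) uf s0 comp_lfunA ud.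
  by rewrite !comp_lfun0l subr0.
case/coboundariesSP => v vH vE; apply/coboundariesSP.
(* Expand u = ufg - uh with uf = vd and h = ds + sd. The term uds vanishes because [u] is a cocycle,
   and this primitive remains. *)
exists ((v \o g k) - (u \o s k))%VF.
  by apply: rmod_homB; apply: rmod_hom_comp.
rewrite [LHS]uE vE sd comp_lfunDr comp_lfunDl comp_lfunNl.
by rewrite (comp_lfunA u) ud comp_lfun0l add0r -!comp_lfunA gd.
Qed.

Lemma cohom_dim_indep P Q N k : cohom_dim P N k = cohom_dim Q N k.
Proof. by apply/eqP; rewrite eqn_leq !cohom_dim_le. Qed.

Lemma Ext_dimE Q N k d : Ext_dim M N k d <-> cohom_dim Q N k = d.
Proof.
by split=> [[P <-]|]; [exact: cohom_dim_indep | exists Q].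
Qed.

(** Cohomology may be computed with the short resolution, whose k-th term is zero. *)
Lemma pd_le_Ext Q N k j : pd_le M j -> (j < k)%N -> cohom_dim Q N k = 0%N.
Proof.
case=> P Pj lt_jk; rewrite (cohom_dim_indep Q P).
have P0 (v : P k) : v = 0.
  have /eqP : \dim {: P k} = 0%N by exact: Pj.
  by rewrite dimv_eq0 => /eqP e; apply/eqP; rewrite -memv0 -e memvf.
suff E0 : cocycles P N k = 0%VS by rewrite /cohom_dim E0 dimv0.
apply/eqP; rewrite -subv0; apply/subvP => f _; rewrite memv0.
by apply/eqP/lfunP => v; rewrite (P0 v) !linear0.
Qed.

End Comparison.
End Modules.

(** * Projective modules generated by idempotents *)

Section Principal.
Variables (F : fieldType) (A : falgType F).

Lemma ract_regE (a : A) (v : reg_mod A) : ract (reg_mod A) a v = v * a :> A.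
Proof. by rewrite /= lfunE /= lfunE. Qed.

Fact limg_amull_stable (e a : A) (v : reg_mod A) :
  v \in limg (amull e) -> ract (reg_mod A) a v \in limg (amull e).
Proof.
case/memv_imgP => u _ ->; rewrite ract_regE lfunE /= -mulrA.
by apply/memv_imgP; exists (u * a); rewrite ?memvf ?lfunE.
Qed.

Definition pmod (e : A) : rmod A := submod (@limg_amull_stable e).

Definition pval (e : A) (x : pmod e) : A := vsval (x : subvs_of (limg (amull e))).

Lemma pval_inj e : injective (@pval e).
Proof. exact: subvs_inj. Qed.

Lemma pval_lin e : linear (@pval e).
Proof. by move=> c x y; rewrite /pval linearP. Qed.

Lemma pval_ract e (x : pmod e) a : pval (ract (pmod e) a x) = pval x * a.
Proof.
have := @val_ract_submod _ _ (reg_mod A) _ (@limg_amull_stable e) a x.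
by rewrite ract_regE.
Qed.

Lemma pval_exists e (x : A) : exists y : pmod e, pval y = e * x.
Proof.
exists (vsproj _ (e * x)); rewrite /pval vsprojK //.
by apply/memv_imgP; exists x; rewrite ?memvf ?lfunE.
Qed.

Definition pgen (e : A) : pmod e := vsproj _ e.

Lemma pval_gen e : pval (pgen e) = e.
Proof.
rewrite /pval vsprojK //; apply/memv_imgP; exists 1; rewrite ?memvf // lfunE /=.
by rewrite mulr1.
Qed.

(** The generator goes to v e, not to v, so that every [v] is allowed; the two agree when [v] lies
    in M e and [e] is idempotent. *)
Definition genmap (e : A) (M : rmod A) (v : M) : 'Hom(pmod e, M) :=
  linfun (fun x : pmod e => ract M (pval x) v).

Lemma genmapE (e : A) (M : rmod A) (v : M) x : genmap e v x = ract M (pval x) v.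
Proof.
by apply: linfun_linearE => c y z; rewrite pval_lin linearP add_lfunE scale_lfunE.
Qed.

Lemma genmap_hom (e : A) (M : rmod A) (v : M) : rmod_hom (genmap e v).
Proof. by move=> x a; rewrite !genmapE pval_ract ractME. Qed.

Section Idempotent.
Variable e : A.
Hypothesis ee : e * e = e.

Lemma pval_idem (x : pmod e) : e * pval x = pval x.
Proof.
have /memv_imgP[y _] := subvsP (x : subvs_of (limg (amull e))).
by rewrite /pval => ->; rewrite lfunE /= mulrA ee.
Qed.

Lemma pmod_gen (x : pmod e) : x = ract (pmod e) (pval x) (pgen e).
Proof. by apply: pval_inj; rewrite pval_ract pval_gen pval_idem. Qed.

Lemma hom_pmodE (M : rmod A) (f : 'Hom(pmod e, M)) (x : pmod e) :
  rmod_hom f -> f x = ract M (pval x) (f (pgen e)).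
Proof. by move=> fH; rewrite -fH -pmod_gen. Qed.

Lemma projective_pmod : projective (pmod e).
Proof.
move=> M N g f gH gS fH.
have : f (pgen e) \in limg g by rewrite gS memvf.
case/memv_imgP => v _ gv; exists (genmap e v); first exact: genmap_hom.
by apply/lfunP => x; rewrite comp_lfunE genmapE gH -gv -hom_pmodE.
Qed.

Lemma dim_pmod0 : e = 0 -> \dim {: pmod e} = 0%N.
Proof.
move=> e0; apply/eqP; rewrite dimv_eq0 -subv0; apply/subvP => x _.
rewrite memv0; apply/eqP; apply: pval_inj.
by rewrite -pval_idem (congr1 (fun a => a * pval x) e0) mul0r /pval linear0.
Qed.

End Idempotent.

(** For idempotent [e], restricting this to homomorphisms gives the isomorphism of Hom_A(eA, X) with
    X e, the latter written [limg (ract X e)]. *)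
Definition ev_gen (e : A) (X : rmod A) : 'Hom('Hom(pmod e, X), X) :=
  linfun (fun f : 'Hom(pmod e, X) => f (pgen e)).

Lemma ev_genE (e : A) (X : rmod A) f : ev_gen e X f = f (pgen e).
Proof.
by apply: linfun_linearE => c f1 f2; rewrite add_lfunE scale_lfunE.
Qed.

Lemma dim_ev_gen (e : A) (X : rmod A) (U : {vspace 'Hom(pmod e, X)}) :
  e * e = e -> (U <= HomA (pmod e) X)%VS -> \dim (ev_gen e X @: U) = \dim U.
Proof.
move=> ee sU; apply: limg_dim_eq; apply/eqP; rewrite -subv0.
apply/subvP => f /memv_capP[/(subvP sU)/HomAP fH].
rewrite memv_ker ev_genE memv0 => /eqP f0; apply/eqP/lfunP => x.
by rewrite (hom_pmodE ee) // f0 zero_lfunE linear0.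
Qed.

Section Cohomology.
Variables (e e' : A) (X : rmod A) (d : 'Hom(pmod e', pmod e)).
Hypotheses (ee : e * e = e) (ee' : e' * e' = e') (dH : rmod_hom d).

Let u := pval (d (pgen e')).

Lemma hom_pmod_d (f : 'Hom(pmod e, X)) :
  rmod_hom f -> f (d (pgen e')) = ract X u (f (pgen e)).
Proof. by move=> fH; rewrite (hom_pmodE ee). Qed.

Lemma hom_pmod_img (f : 'Hom(pmod e, X)) :
  rmod_hom f -> f (pgen e) \in limg (ract X e).
Proof.
by move=> fH; rewrite (hom_pmodE ee) // pval_gen memv_img ?memvf.
Qed.

Lemma genmap_gen (v : X) : v \in limg (ract X e) -> genmap e v (pgen e) = v.
Proof.
by case/memv_imgP => w _ ->; rewrite genmapE pval_gen -ractME ee.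
Qed.

(** Under evaluation at the generators, precomposition with [d] becomes the action of [u], the image
    under [d] of the generator of e'A. *)
Lemma dim_HomA_ker :
  \dim (HomA (pmod e) X :&: lker (precomp X d))
  = \dim (limg (ract X e) :&: lker (ract X u)).
Proof.
rewrite -(dim_ev_gen ee (capvSl _ _)); congr (\dim _); apply/vspaceP => v.
apply/idP/idP.
  case/memv_imgP => f /memv_capP[/HomAP fH].
  rewrite memv_ker precompE ev_genE => /eqP f0 ->.
  rewrite memv_cap hom_pmod_img // memv_ker -hom_pmod_d //.
  by rewrite -comp_lfunE f0 zero_lfunE eqxx.
case/memv_capP => ve; rewrite memv_ker => /eqP vu.
apply/memv_imgP; exists (genmap e v); last by rewrite ev_genE genmap_gen.
rewrite memv_cap memv_ker precompE; apply/andP; split.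
  by apply/HomAP; apply: genmap_hom.
apply/eqP/lfunP => x; rewrite comp_lfunE (hom_pmodE ee' x dH) genmap_hom.
by rewrite hom_pmod_d ?genmap_gen ?vu ?linear0 ?zero_lfunE //; exact: genmap_hom.
Qed.

Lemma dim_HomA_img :
  \dim (precomp X d @: HomA (pmod e) X) = \dim (ract X u @: limg (ract X e)).
Proof.
rewrite -(@dim_ev_gen e') //; last first.
  apply/subvP => _ /memv_imgP[f /HomAP fH ->]; rewrite precompE.
  by apply/HomAP; apply: rmod_hom_comp.
congr (\dim _); apply/vspaceP => v; apply/idP/idP.
  case/memv_imgP => _ /memv_imgP[f /HomAP fH ->] ->.
  rewrite ev_genE precompE comp_lfunE hom_pmod_d //.
  exact/memv_img/hom_pmod_img.
case/memv_imgP => w we ->; apply/memv_imgP; exists (precomp X d (genmap e w)).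
  by apply/memv_img/HomAP; apply: genmap_hom.
rewrite ev_genE precompE comp_lfunE hom_pmod_d ?genmap_gen //; exact: genmap_hom.
Qed.

End Cohomology.
End Principal.

(** * Structure of linear Nakayama algebras *)

(** Applying [t k] to an expression of [b k] in the other vectors kills that expression but fixes
    the nonzero [b k]. *)
Lemma free_separated (K : fieldType) (V : vectType K) (b : nat -> V)
    (t : nat -> 'End(V)) (s : seq nat) :
  uniq s -> (forall k, k \in s -> b k != 0) ->
  (forall k, k \in s -> t k (b k) = b k) ->
  (forall k l, k != l -> t k (b l) = 0) -> free (map b s).
Proof.
move=> us b0 tb tb0; elim: s us b0 tb => [|k s IHs] /=; first by rewrite nil_free.
case/andP=> ks us b0 tb; rewrite free_cons IHs //; last 2 first.
- by move=> l ls; apply: b0; rewrite inE ls orbT.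
- by move=> l ls; apply: tb; rewrite inE ls orbT.
rewrite andbT; apply/negP => bk; have := b0 k; rewrite mem_head => /(_ isT)/eqP.
apply; rewrite -(tb k) ?mem_head //; apply/eqP; rewrite -memv_ker.
move: (b k) bk; apply/subvP/span_subvP => _ /mapP[l ls ->].
by rewrite memv_ker tb0 //; apply: contraNneq ks => ->.
Qed.

Section PathElements.
Variables (F : fieldType) (N : nat).
Implicit Types x y : pathalg F N.+1.

(* Zero unless i <= j <= N. *)
Definition pth (i j : nat) : pathalg F N.+1 :=
  [ffun q => ((src q == i :> nat) && (tgt q == j :> nat))%:R].

Lemma pth_pelt (q : lpath N.+1) : pelt F q = pth (src q) (tgt q).
Proof.
by apply/ffunP => r; rewrite !ffunE; congr (nat_of_bool _)%:R.
Qed.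

Lemma pth_exists i j : (i <= j <= N)%N ->
  exists q : lpath N.+1,
    [/\ src q = i :> nat, tgt q = j :> nat & pth i j = pelt F q].
Proof.
case/andP=> le_ij le_jN; have ltj : (j < N.+1)%N by [].
have lti : (i < N.+1)%N by rewrite (leq_ltn_trans le_ij).
pose q : lpath N.+1 := 
  exist (fun p : 'I_N.+1 * 'I_N.+1 => (p.1 <= p.2)%N)
    (Ordinal lti, Ordinal ltj) le_ij.
by exists q; rewrite pth_pelt.
Qed.

Lemma pth_out i j : ~~ (i <= j <= N)%N -> pth i j = 0.
Proof.
move=> out; apply/ffunP => q; rewrite !ffunE; case: andP => // -[/eqP si /eqP tj].
case/negP: out; rewrite -si -tj (svalP q) /=; exact: ltn_ord (tgt q).
Qed.

Lemma peltM (r s : lpath N.+1) :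
  pelt F r * pelt F s = [ffun q => (is_concat r s q)%:R].
Proof.
apply/ffunP => q; rewrite !ffunE (bigD1 r) //= [X in _ + X]big1 ?addr0; last first.
  by move=> r' ne; rewrite big1 // => s' _; rewrite /coefq !ffunE (negPf ne) mul0r.
rewrite /coefq; have [c|nc] := boolP (is_concat r s q).
  rewrite (bigD1 s) //= !ffunE !eqxx mulr1 big1 ?addr0 // => s' /andP[_ ne].
  by rewrite !ffunE (negPf ne) mulr0.
rewrite big1 // => s' c'; rewrite !ffunE.
case: (s' =P s) => [E|_]; last by rewrite mulr0.
by rewrite -E c' in nc.
Qed.

Lemma pthM i j l : (i <= j <= l)%N -> pth i j * pth j l = pth i l.
Proof.
case/andP=> le_ij le_jl; have [le_lN|lt_Nl] := leqP l N; last first.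
  by rewrite !(pth_out (j := l)) ?mulr0 //; lia.
have ij : (i <= j <= N)%N by rewrite le_ij (leq_trans le_jl).
have jl : (j <= l <= N)%N by rewrite le_jl.
have [r [sr tr ->]] := pth_exists ij; have [s [ss ts ->]] := pth_exists jl.
rewrite peltM; apply/ffunP => q; rewrite !ffunE /is_concat.
by rewrite -!val_eqE /= sr tr ss ts eqxx.
Qed.

Lemma pthM0 i j k l : j != k -> pth i j * pth k l = 0.
Proof.
move=> ne_jk; have [ij|/pth_out->] := boolP (i <= j <= N)%N; last by rewrite mul0r.
have [kl|/pth_out->] := boolP (k <= l <= N)%N; last by rewrite mulr0.
have [r [_ tr ->]] := pth_exists ij; have [s [ss _ ->]] := pth_exists kl.
rewrite peltM; apply/ffunP => q; rewrite !ffunE /is_concat.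
by rewrite -val_eqE /= tr ss (negPf ne_jk).
Qed.

Lemma sum_pth : \sum_(i < N.+1) pth i i = 1.
Proof. by apply: eq_bigr => i _; rewrite pth_pelt. Qed.

Lemma pathalg_sum x : x = \sum_(q : lpath N.+1) coefq x q *: pelt F q.
Proof.
apply/ffunP => r; rewrite sum_ffunE (bigD1 r) //= !ffunE eqxx big1 ?addr0.
  by rewrite [RHS]mulr1.
by move=> q ne; rewrite !ffunE eq_sym (negPf ne) [LHS]mulr0.
Qed.

(** At most one path joins i to j. The scalar is its coefficient in [x], written as a sum so that it
    is 0 when there is no such path. *)
Lemma pth_peirce x i j : exists c, pth i i * x * pth j j = c *: pth i j.
Proof.
exists (\sum_(q : lpath N.+1 | (src q == i :> nat) && (tgt q == j :> nat))
          coefq x q).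
rewrite [in LHS](pathalg_sum x) mulr_sumr mulr_suml scaler_suml [RHS]big_mkcond.
apply: eq_bigr => q _; rewrite -scalerAr -scalerAl pth_pelt.
have [<-|ne] := eqVneq (src q : nat) i; last first.
  by rewrite pthM0 ?mul0r ?scaler0 // eq_sym.
have le_q : (src q <= tgt q)%N by exact: svalP q.
rewrite pthM ?leqnn //; have [<-|ne] := eqVneq (tgt q : nat) j; last first.
  by rewrite pthM0 ?scaler0.
by rewrite pthM // le_q leqnn.
Qed.

Definition coef_form (q : lpath N.+1) : 'Hom(pathalg F N.+1, F^o) :=
  linfun (fun x : pathalg F N.+1 => coefq x q : F^o).

Lemma coef_formE q x : coef_form q x = coefq x q.
Proof.
by apply: linfun_linearE => c y z; rewrite /coefq !ffunE.
Qed.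

Lemma mem_coef_form q x : (x \in lker (coef_form q)) = (coefq x q == 0).
Proof. by rewrite memv_ker coef_formE. Qed.

Lemma coef_arrow_ideal x (q : lpath N.+1) :
  x \in arrow_ideal F N -> plen q = 0%N -> coefq x q = 0.
Proof.
move=> xJ q0; have {q0}-> : q = tpath (src q).
  apply: lpath_eq => //; apply: val_inj; apply/eqP; rewrite eqn_leq /=.
  by rewrite -subn_eq0 -/(plen q) q0 eqxx; exact: svalP q.
move: (src q) => i; apply/eqP; rewrite -mem_coef_form; move: x xJ.
apply/subvP/prodvP => y z yJ _; rewrite mem_coef_form coef_tpathM.
suff /eqP-> : coefq y (tpath i) == 0 by rewrite mul0r.
rewrite -mem_coef_form; move: y yJ; apply/subvP/prodvP => y' z' _ z'J.
rewrite mem_coef_form coef_tpathM.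
suff /eqP-> : coefq z' (tpath i) == 0 by rewrite mulr0.
rewrite -mem_coef_form; move: z' z'J; apply/subvP/span_subvP => _ /imageP[r r1 ->].
rewrite mem_coef_form /coefq ffunE.
case: (tpath i =P r) => [ri|_]; last by rewrite eqxx.
by move: r1; rewrite inE -ri /plen subnn.
Qed.

(** When a path of length at most one is split in two, one piece is trivial, and elements of J have
    coefficient 0 on trivial paths. *)
Lemma coef_arrow_ideal2 x (q : lpath N.+1) :
  x \in (arrow_ideal F N ^+ 2)%VS -> (plen q <= 1)%N -> coefq x q = 0.
Proof.
move=> xJ q1; apply/eqP; rewrite -mem_coef_form; move: x xJ; rewrite expv2.
apply/subvP/prodvP => y z yJ zJ; rewrite mem_coef_form /coefq ffunE.
apply/eqP; rewrite big1 // => r _; rewrite big1 // => s.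
case/and3P => /eqP rs /eqP qr /eqP qs.
have [r0|r0] := eqVneq (plen r) 0%N; first by rewrite (coef_arrow_ideal yJ) ?mul0r.
rewrite (coef_arrow_ideal zJ) ?mulr0 //.
have := svalP r; have := svalP s; rewrite -/(src s) -/(src r) -/(tgt s) -/(tgt r).
move: q1 r0; rewrite /plen qr qs rs; lia.
Qed.

End PathElements.

Section Structure.
Variables (F : fieldType) (N : nat) (A : LNakayama F N).

Definition pe (i j : nat) : A := lnak_pi A (pth F N i j).

Lemma lnak_piP (a : A) : exists x, a = lnak_pi A x.
Proof.
have : a \in limg (lnak_pi A) by rewrite lnak_surj memvf.
by case/memv_imgP => x _ ->; exists x.
Qed.

Lemma idem_pe (i : 'I_N.+1) : idem A i = pe i i.
Proof. by rewrite /idem pth_pelt. Qed.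

Lemma pe_out i j : ~~ (i <= j <= N)%N -> pe i j = 0.
Proof. by move=> out; rewrite /pe pth_out ?linear0. Qed.

Lemma peM i j l : (i <= j <= l)%N -> pe i j * pe j l = pe i l.
Proof. by move=> ijl; rewrite /pe -rmorphM pthM. Qed.

Lemma peM0 i j k l : j != k -> pe i j * pe k l = 0.
Proof. by move=> ne; rewrite /pe -rmorphM pthM0 ?rmorph0. Qed.

Lemma pe_idem i : pe i i * pe i i = pe i i.
Proof. by rewrite peM ?leqnn. Qed.

Lemma pe_idl i j : pe i i * pe i j = pe i j.
Proof.
have [le_ij|lt_ji] := leqP i j; first by rewrite peM ?leqnn.
by rewrite (pe_out (j := j)) ?mulr0 // negb_and -ltnNge lt_ji.
Qed.

Lemma pe_idr i j : pe i j * pe j j = pe i j.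
Proof.
have [le_ij|lt_ji] := leqP i j; first by rewrite peM ?leqnn ?le_ij.
by rewrite (pe_out (j := j)) ?mul0r // negb_and -ltnNge lt_ji.
Qed.

Lemma sum_pe : \sum_(i < N.+1) pe i i = 1.
Proof. by rewrite -linear_sum sum_pth rmorph1. Qed.

Lemma pe_peirce a i j : exists c, pe i i * a * pe j j = c *: pe i j.
Proof.
have [x ->] := lnak_piP a; have [c E] := pth_peirce x i j.
by exists c; rewrite -!rmorphM E [LHS]linearZ.
Qed.

Lemma pe_row a : a = \sum_(j < N.+1) a * pe j j.
Proof. by rewrite -mulr_sumr sum_pe mulr1. Qed.

Lemma pe_col a : a = \sum_(i < N.+1) pe i i * a.
Proof. by rewrite -mulr_suml sum_pe mul1r. Qed.

(** The kernel of the presentation lies in J^2, so paths of length at most one survive in A. *)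
Lemma pe_short_neq0 i j : (i <= j <= N)%N -> (j <= i.+1)%N -> pe i j != 0.
Proof.
move=> ij short; have [q [sq tq E]] := pth_exists F ij.
rewrite /pe -memv_ker; apply/negP => /(subvP (lnak_adm A).2) pJ.
have q1 : (plen q <= 1)%N by rewrite /plen; lia.
by have /eqP := coef_arrow_ideal2 pJ q1; rewrite E /coefq ffunE eqxx oner_eq0.
Qed.

Lemma pe_neq0_tgt i j l : (i <= j <= l)%N -> pe i l != 0 -> pe i j != 0.
Proof. by move=> ijl; apply: contraNneq => E; rewrite -(peM ijl) E mul0r. Qed.

Lemma pe_neq0_src i j l : (i <= j <= l)%N -> pe i l != 0 -> pe j l != 0.
Proof. by move=> ijl; apply: contraNneq => E; rewrite -(peM ijl) E mulr0. Qed.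

(* This is h_i = i + c_i - 1, the height of the Dyck path in column i. *)
Definition reach (i : nat) : nat := \max_(j < N.+1 | pe i j != 0) j.

(** Initial pieces of a nonzero path are nonzero, so the targets of the nonzero paths from i fill an
    interval starting at i. *)
Lemma pe_neq0 i j : (i <= N)%N -> (pe i j != 0) = (i <= j <= reach i)%N.
Proof.
move=> iN; apply/idP/idP => [nz|/andP[le_ij le_jr]].
  have /andP[le_ij le_jN] : (i <= j <= N)%N by apply: contraNT nz => /pe_out->.
  by rewrite le_ij (@leq_bigmax_cond _ _ _ (Ordinal (le_jN : (j < N.+1)%N))).
have i0 : pe i (Ordinal (iN : (i < N.+1)%N)) != 0 by rewrite pe_short_neq0 ?leqnn.
apply: (@pe_neq0_tgt i j (reach i)); first by rewrite le_ij.
rewrite /reach (bigop.bigmax_eq_arg (Ordinal (iN : (i < N.+1)%N))) //.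
by case: arg_maxnP.
Qed.

Lemma pe_eq0 i j : (reach i < j)%N -> pe i j = 0.
Proof.
move=> lt_rj; have [iN|Ni] := leqP i N; last by rewrite pe_out //; lia.
by apply/eqP; rewrite -[_ == _]negbK pe_neq0 // negb_and -!ltnNge lt_rj orbT.
Qed.

Lemma reach_leN i : (reach i <= N)%N.
Proof. by apply/bigmax_leqP => j _; rewrite -ltnS. Qed.

Lemma reach_ge i : (i <= N)%N -> (i <= reach i)%N.
Proof. by move=> iN; have := pe_neq0 i iN; rewrite pe_short_neq0 ?leqnn; lia. Qed.

Lemma reach_gt i : (i < N)%N -> (i < reach i)%N.
Proof.
by move=> iN; have := pe_neq0 i.+1 (ltnW iN); rewrite pe_short_neq0 ?leqnSn; lia.
Qed.

(** If j does not exceed [reach i], the tail from j of the nonzero path from i to [reach i] is again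
    nonzero. *)
Lemma reach_mono i j : (i <= j <= N)%N -> (reach i <= reach j)%N.
Proof.
case/andP => ij jN; have [le_rj|lt_jr] := leqP (reach i) j.
  by rewrite (leq_trans le_rj) ?reach_ge.
have iN := leq_trans ij jN; have := pe_neq0 (reach i) iN.
rewrite reach_ge // leqnn => /(@pe_neq0_src i j); rewrite ij ltnW // => /(_ isT).
by rewrite pe_neq0 // => /andP[].
Qed.

(** The nonzero paths from i form a basis of e_i A: right multiplication by the trivial paths
    separates them, and the Peirce decomposition shows that they span. *)
Lemma dim_pe_row (i : nat) (s : seq nat) : uniq s ->
  (forall j, (j \in s) = (pe i j != 0)) ->
  \dim (limg (amull (pe i i))) = size s.
Proof.
move=> us sP.
have fr : free (map (pe i) s).
  apply: (@free_separated _ _ _ (fun j => amulr (pe j j))) => // k.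
  - by rewrite sP.
  - by rewrite lfunE /= pe_idr.
  - by move=> l ne; rewrite lfunE /= peM0 // eq_sym.
rewrite -(size_map (pe i)) -(eqP fr); congr (\dim _).
apply/eqP; rewrite eqEsubv; apply/andP; split.
  apply/subvP => _ /memv_imgP[a _ ->]; rewrite lfunE /=.
  rewrite (pe_row (pe i i * a)); apply: memv_suml => j _.
  have [c ->] := pe_peirce a i j.
  have [->|nz] := eqVneq (pe i j) 0; first by rewrite scaler0 mem0v.
  by apply/memvZ/memv_span/mapP; exists (j : nat); rewrite ?sP.
apply/span_subvP => _ /mapP[j _ ->]; apply/memv_imgP; exists (pe i j).
  by rewrite memvf.
by rewrite lfunE /= pe_idl.
Qed.

Lemma dim_pe_col (j : nat) (s : seq nat) : uniq s ->
  (forall i, (i \in s) = (pe i j != 0)) ->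
  \dim (limg (amulr (pe j j))) = size s.
Proof.
move=> us sP.
have fr : free (map (pe^~ j) s).
  apply: (@free_separated _ _ _ (fun i => amull (pe i i))) => // k.
  - by rewrite sP.
  - by rewrite lfunE /= pe_idl.
  - by move=> l ne; rewrite lfunE /= peM0.
rewrite -(size_map (pe^~ j)) -(eqP fr); congr (\dim _).
apply/eqP; rewrite eqEsubv; apply/andP; split.
  apply/subvP => _ /memv_imgP[a _ ->]; rewrite lfunE /=.
  rewrite (pe_col (a * pe j j)); apply: memv_suml => i _.
  rewrite mulrA; have [c ->] := pe_peirce a i j.
  have [->|nz] := eqVneq (pe i j) 0; first by rewrite scaler0 mem0v.
  by apply/memvZ/memv_span/mapP; exists (i : nat); rewrite ?sP.
apply/span_subvP => _ /mapP[i _ ->]; apply/memv_imgP; exists (pe i j).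
  by rewrite memvf.
by rewrite lfunE /= pe_idr.
Qed.

Lemma kupischE (i : 'I_N.+1) : kupisch A i = (reach i - i).+1%N.
Proof.
have iN : (i <= N)%N by rewrite -ltnS.
have ri := reach_ge iN; rewrite -(size_iota i (reach i - i).+1).
rewrite -(@dim_pe_row i) ?iota_uniq //; last first.
  by move=> j; rewrite pe_neq0 // mem_iota; lia.
rewrite /kupisch idem_pe; congr (\dim _).
apply/eqP; rewrite eqEsubv; apply/andP; split.
  apply/prodvP => _ a /vlineP[c ->] _; apply/memv_imgP; exists (c *: a).
    by rewrite memvf.
  by rewrite lfunE /= -scalerAl scalerAr.
apply/subvP => _ /memv_imgP[a _ ->]; rewrite lfunE /=.
by rewrite memv_mul ?memv_line ?memvf.
Qed.

End Structure.

(** * Minimal resolutions of simple modules *)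

Section Resolution.
Variables (F : fieldType) (N : nat) (A : LNakayama F N).
Local Notation pe := (pe A).
Local Notation reach := (reach A).
Local Notation proj a := (pmod (pe a a)).

(** The surviving components of [x] are multiples of paths from b to some j at or beyond c, and each
    such path factors through the path from b to c. *)
Lemma pe_row_image b c (x : A) :
  (b <= c)%N -> pe b b * x = x ->
  (forall j, (b <= j < c)%N -> x * pe j j = 0) ->
  exists z, x = pe b c * z.
Proof.
move=> le_bc xb x0; have : x \in limg (amull (pe b c)).
  rewrite (pe_row x); apply: memv_suml => j _; rewrite -xb.
  have [t E] := pe_peirce x b j.
  have [lt_jb|le_bj] := ltnP j b.
    by rewrite E pe_out ?scaler0 ?mem0v // negb_and -ltnNge lt_jb.
  have [lt_jc|le_cj] := ltnP j c; first by rewrite xb x0 ?mem0v // le_bj.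
  rewrite E -(@peM _ _ _ b c j) ?le_bc // memvZ //; apply/memv_imgP.
  by exists (pe c j); rewrite ?memvf ?lfunE.
by case/memv_imgP => z _ ->; exists z; rewrite lfunE.
Qed.

Definition shift a b : 'Hom(proj b, proj a) :=
  genmap (pe b b) (vsproj _ (pe a b) : proj a).

Lemma shift_hom a b : rmod_hom (shift a b).
Proof. exact: genmap_hom. Qed.

Lemma pval_shift a b x : pval (shift a b x) = pe a b * pval x.
Proof.
rewrite genmapE pval_ract; congr (_ * _); rewrite /pval vsprojK //.
by apply/memv_imgP; exists (pe a b); rewrite ?memvf // lfunE /= pe_idl.
Qed.

Lemma pval_shift_gen a b : pval (shift a b (pgen _)) = pe a b.
Proof. by rewrite pval_shift pval_gen pe_idr. Qed.

Lemma mem_limg_shift b c (x : proj b) z :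
  pval x = pe b c * z -> x \in limg (shift b c).
Proof.
move=> xz; have [y yz] := pval_exists (pe c c) z.
apply/memv_imgP; exists y; rewrite ?memvf //; apply: pval_inj.
by rewrite pval_shift yz mulrA pe_idr.
Qed.

Lemma shift_ker a b (x : proj b) :
  (x \in lker (shift a b)) = (pe a b * pval x == 0).
Proof.
rewrite memv_ker -pval_shift; apply/eqP/eqP => [->|x0].
  by rewrite /pval linear0.
by apply: pval_inj; rewrite x0 /pval linear0.
Qed.

(** For a < b <= [reach a], the kernel of e_b A -> e_a A is spanned by the paths from b that end
    beyond [reach a]. It is generated by the shortest of them if one is nonzero; otherwise it is
    zero, encoded by the vertex N.+1. *)
Definition nxt a b :=
  if (b <= N)%N && (reach a < reach b)%N then (reach a).+1 else N.+1.

Lemma nxt_gt a b : (reach a < nxt a b)%N.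
Proof. by rewrite /nxt; case: ifP => // _; rewrite ltnS reach_leN. Qed.

Lemma shift_exact a b : (a < b <= reach a)%N ->
  limg (shift b (nxt a b)) = lker (shift a b).
Proof.
move=> /andP[lt_ab le_br]; have lt_rc := nxt_gt a b.
have bN := leq_trans le_br (reach_leN A a); have aN : (a <= N)%N by lia.
apply/vspaceP => x; apply/idP/idP.
  case/memv_imgP => y _ ->; rewrite shift_ker pval_shift mulrA peM; last by lia.
  by rewrite pe_eq0 ?mul0r.
rewrite shift_ker => /eqP x0.
have xb : pe b b * pval x = pval x by rewrite pval_idem // pe_idem.
suff [z] : exists z, pval x = pe b (nxt a b) * z by apply: mem_limg_shift.
apply: pe_row_image => // [|j /andP[le_bj lt_jc]]; first by lia.
have [t E] := pe_peirce (pval x) b j; rewrite -xb E.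
(* Up to [reach a] the path from a to j is nonzero, which forces the scalar [t] to vanish. Beyond
   it, j < [nxt a b] leaves only the case where [reach b] is at most [reach a], so the path from b
   to j is zero. *)
have [le_jr|lt_rj] := leqP j (reach a).
  have /eqP : pe a b * (pe b b * pval x * pe j j) = 0.
    by rewrite xb mulrA x0 mul0r.
  rewrite E -scalerAr peM ?(ltnW lt_ab) // scaler_eq0 => /orP[/eqP->|].
    by rewrite scale0r.
  by have := pe_neq0 A j aN; case: eqP => // _; lia.
rewrite pe_eq0 ?scaler0 //; move: lt_jc; rewrite /nxt bN /=.
by case: (ltnP (reach a) (reach b)); lia.
Qed.

Lemma proj_out b (x : proj b) : (N < b)%N -> x = 0.
Proof.
move=> Nb; apply: pval_inj; rewrite -pval_idem ?pe_idem // /pval linear0.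
rewrite (congr1 (fun a => a * pval x) (pe_out A (_ : ~~ (b <= b <= N)%N))).
  by rewrite mul0r.
by rewrite negb_and -!ltnNge Nb orbT.
Qed.

Lemma shift_exact_out a b c : (N < b)%N -> limg (shift b c) = lker (shift a b).
Proof.
by move=> Nb; apply/vspaceP => x; rewrite (proj_out x Nb) !mem0v.
Qed.

Lemma ract_simple_pe (i : 'I_N.+1) j k (v : simple_at A i) :
  ract (simple_at A i) (pe j k) v = ((i == j :> nat) && (i == k :> nat))%:R *: v.
Proof. by rewrite ract_simpleE scale_lfunE id_lfunE /coefq ffunE. Qed.

Section SimpleResolution.
Variable i : 'I_N.+1.
Hypothesis iN : (i < N)%N.

(* The vertices of the k-th and (k+1)-st terms of the minimal projective
   resolution of S_i; the out-of-range vertex N.+1 stands for the zero module. *)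
Fixpoint vtx (k : nat) : nat * nat :=
  if k is j.+1 then ((vtx j).2, nxt (vtx j).1 (vtx j).2) else (i : nat, i.+1).

(** Either the next term is the zero module, or the hypothesis of [shift_exact] holds. *)
Lemma vtxP k : (vtx k).2 = N.+1 \/ ((vtx k).1 < (vtx k).2 <= reach (vtx k).1)%N.
Proof.
elim: k => [|k [IH|IH]] /=; first by right; rewrite ltnSn reach_gt.
  by left; rewrite /nxt IH ltnn.
rewrite /nxt; case: ifP => [/andP[_ lt]|_]; [right; lia | by left].
Qed.

Lemma vtx_out j k : (j <= k)%N -> (N < (vtx j).1)%N -> (N < (vtx k).1)%N.
Proof.
move=> + out; elim: k => [|k IH]; first by rewrite leqn0 => /eqP <-.
rewrite leq_eqVlt => /orP[/eqP <-//|/IH Nk] /=.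
by case: (vtxP k) => [->//|]; lia.
Qed.

Definition simple_gen : simple_at A i := (1 : F).

Definition simple_eps : 'Hom(proj (vtx 0).1, simple_at A i) :=
  genmap (pe i i) simple_gen.

Lemma simple_epsE x :
  simple_eps x = ract (simple_at A i) (pval x) simple_gen.
Proof. exact: genmapE. Qed.

Lemma simple_genP (v : simple_at A i) : v = (v : F) *: simple_gen.
Proof. by rewrite /simple_gen; exact/esym/mulr1. Qed.

Lemma simple_gen_neq0 : simple_gen != 0.
Proof. exact: oner_neq0. Qed.

Lemma simple_eps_surj : limg simple_eps = fullv.
Proof.
apply/eqP; rewrite eqEsubv subvf; apply/subvP => v _.
rewrite (simple_genP v) memvZ //; apply/memv_imgP.
exists (pgen _); rewrite ?memvf // simple_epsE pval_gen ract_simple_pe !eqxx.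
by rewrite scale1r.
Qed.

Lemma simple_eps_exact : limg (shift (vtx 0).1 (vtx 0).2) = lker simple_eps.
Proof.
apply/vspaceP => x; apply/idP/idP => /=.
  case/memv_imgP => y _ ->; rewrite memv_ker simple_epsE pval_shift ractME.
  by rewrite ract_simple_pe eqxx ltn_eqF // scale0r linear0.
rewrite memv_ker simple_epsE => /eqP x0.
have xi : pe i i * pval x = pval x by rewrite pval_idem // pe_idem.
suff [z] : exists z, pval x = pe i i.+1 * z by apply: mem_limg_shift.
apply: pe_row_image => // j ij; have {ij}-> : j = i by lia.
have [t E] := pe_peirce (pval x) i i.
have /eqP : ract (simple_at A i) (pe i i * pval x * pe i i) simple_gen = 0.
  by rewrite xi ractME x0 linear0.
rewrite -{2}xi E linearZ /= scale_lfunE ract_simple_pe !eqxx scale1r.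
by rewrite scaler_eq0 (negPf simple_gen_neq0) orbF => /eqP->; rewrite scale0r.
Qed.

Lemma vtx_exact k :
  limg (shift (vtx k.+1).1 (vtx k.+1).2) = lker (shift (vtx k).1 (vtx k).2).
Proof.
case: (vtxP k) => [out|ok] /=; last exact: shift_exact.
by apply: shift_exact_out; rewrite out.
Qed.

Definition simple_res : proj_res (simple_at A i) :=
  @ProjRes F A (simple_at A i) (fun k => proj (vtx k).1)
    (fun k => shift (vtx k).1 (vtx k).2) simple_eps
    (fun k => projective_pmod (pe_idem A _))
    (fun k => @shift_hom _ _) (@genmap_hom _ _ _ _ _) simple_eps_surj
    simple_eps_exact vtx_exact.

Section ExtDim.
Variable X : rmod A.

(** Cocycles and coboundaries after identifying Hom_A(e_a A, X) with X e_a. Note the shift: [bdim k]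
    measures the coboundaries in degree k+1. *)
Definition zdim k :=
  \dim (limg (ract X (pe (vtx k).1 (vtx k).1))
        :&: lker (ract X (pe (vtx k).1 (vtx k).2)))%VS.
Definition bdim k :=
  \dim (ract X (pe (vtx k).1 (vtx k).2)
        @: limg (ract X (pe (vtx k).1 (vtx k).1)))%VS.

Lemma zdimE k : \dim (cocycles simple_res X k) = zdim k.
Proof.
have := @dim_HomA_ker _ _ _ _ X _ (pe_idem A (vtx k).1) (pe_idem A (vtx k).2)
  (@shift_hom (vtx k).1 (vtx k).2).
by rewrite pval_shift_gen.
Qed.

Lemma bdimE k : \dim (coboundaries simple_res X k.+1) = bdim k.
Proof.
have := @dim_HomA_img _ _ _ _ X _ (pe_idem A (vtx k).1) (pe_idem A (vtx k).2)
  (@shift_hom (vtx k).1 (vtx k).2).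
by rewrite pval_shift_gen.
Qed.

Lemma cohom0E : cohom_dim simple_res X 0 = zdim 0.
Proof. by rewrite /cohom_dim zdimE dimv0 subn0. Qed.

Lemma cohomSE k : cohom_dim simple_res X k.+1 = (zdim k.+1 - bdim k)%N.
Proof. by rewrite /cohom_dim zdimE bdimE. Qed.

Lemma bdim_le_zdim k : (bdim k <= zdim k.+1)%N.
Proof. by rewrite -zdimE -bdimE dimvS ?coboundaries_sub. Qed.

Lemma zdim_bdim k :
  (zdim k + bdim k)%N = \dim (limg (ract X (pe (vtx k).1 (vtx k).1))).
Proof. exact: limg_ker_dim. Qed.

Lemma bdim_out k : (N < (vtx k).2)%N -> bdim k = 0%N.
Proof.
move=> out; apply/eqP; rewrite dimv_eq0 -subv0; apply/subvP.
move=> _ /memv_imgP[v _ ->]; rewrite pe_out ?ract0l ?mem0v //.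
by rewrite negb_and -!ltnNge out orbT.
Qed.

End ExtDim.

(** This is minimality. If the term of degree k+1 sits at a genuine vertex m, the neighbouring
    differentials of Hom_A(P, S_m) vanish, because paths between distinct vertices act as zero on
    S_m. Hence Ext^{k+1}(S_i, S_m) is nonzero. *)
Lemma pd_le_simple k :
  pd_le (simple_at A i) k <-> (N < (vtx k.+1).1)%N.
Proof.
split=> [pdk|out]; last first.
  exists simple_res => j lt_kj; apply: dim_pmod0; first exact: pe_idem.
  apply: pe_out; have := vtx_out lt_kj out; lia.
rewrite ltnNge; apply/negP => le_aN.
pose m : 'I_N.+1 := Ordinal (le_aN : ((vtx k.+1).1 < N.+1)%N).
have := pd_le_Ext simple_res (simple_at A m) pdk (ltnSn k).
have mE : m = (vtx k).2 :> nat by [].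
rewrite cohomSE; have -> : bdim (simple_at A m) k = 0%N.
  apply/eqP; rewrite dimv_eq0 -subv0; apply/subvP => _ /memv_imgP[v _ ->].
  rewrite ract_simple_pe gtn_eqF ?scale0r ?mem0v //.
  by case: (vtxP k) => [E|/andP[]//]; have := le_aN; rewrite /= E ltnn.
rewrite subn0 => /eqP; rewrite dimv_eq0 => /eqP z0.
suff : (simple_gen : simple_at A m) \in (0%VS : {vspace simple_at A m}).
  by rewrite memv0 (negPf simple_gen_neq0).
rewrite -z0 memv_cap memv_ker; apply/andP; split.
  apply/memv_imgP; exists simple_gen; rewrite ?memvf // ract_simple_pe mE /=.
  by rewrite !eqxx scale1r.
rewrite ract_simple_pe [X in _ && X]ltn_eqF ?andbF ?scale0r //.
by case: (vtxP k.+1) => [-> //|/andP[]].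
Qed.

End SimpleResolution.
End Resolution.

(** * Regularity of simple modules by dimension counts *)

Section Regularity.
Variables (F : fieldType) (N : nat) (A : LNakayama F N).
Variable i : 'I_N.+1.
Hypothesis iN : (i < N)%N.
Local Notation pe := (pe A).
Local Notation reach := (reach A).
Local Notation S := (simple_at A i).
Local Notation regA := (reg_mod A).
Local Notation vtx := (vtx A i).
Local Notation zdim := (zdim i regA).
Local Notation bdim := (bdim i regA).
Local Notation cohom k := (cohom_dim (simple_res A iN) regA k).

Definition coldim j := size [seq k <- iota 0 N.+1 | pe k j != 0].

Lemma coldimE j : \dim (limg (ract regA (pe j j))) = coldim j.
Proof.
rewrite [X in limg X](_ : _ = amulr (pe j j)); last by rewrite /= lfunE.
apply: dim_pe_col => [|k]; first by rewrite filter_uniq ?iota_uniq.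
rewrite mem_filter mem_iota add0n /=; case: ltnP; rewrite ?andbT // andbF => Nk.
by rewrite pe_out ?eqxx //; lia.
Qed.

(** Hom_A(S_i, A) is the part of A e_i killed by the arrow from i to i+1, and a nonzero path from k
    to i is killed exactly when [reach k] is i. *)
Lemma ext0_eq0 : zdim 0 = 0%N <-> (forall k, (k <= N)%N -> reach k <> i).
Proof.
split=> [/eqP + k kN ki|nr].
  rewrite dimv_eq0 => /eqP z0.
  have nz : pe k i != 0 by rewrite pe_neq0 // -ki reach_ge // leqnn.
  suff : (pe k i : regA) \in (0%VS : {vspace regA}) by rewrite memv0 (negPf nz).
  rewrite -z0 memv_cap memv_ker ract_regE /= peM; last first.
    by have := reach_ge A kN; rewrite ki; lia.
  have -> : pe k i.+1 = 0 by rewrite pe_eq0 // ki.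
  rewrite eqxx andbT; apply/memv_imgP; exists (pe k i).
    by rewrite memvf.
  by rewrite ract_regE pe_idr.
apply/eqP; rewrite dimv_eq0 -subv0; apply/subvP => x.
case/memv_capP => /memv_imgP[y _ ->]; rewrite memv_ker !ract_regE /= => /eqP.
rewrite -mulrA pe_idl => y0; rewrite memv0; apply/eqP.
rewrite [LHS](pe_col (y * pe i i)); apply: big1 => k _.
have kN : (k <= N)%N by rewrite -ltnS.
rewrite mulrA; have [c E] := pe_peirce y k i.
have /eqP : pe k k * y * pe i i * pe i i.+1 = 0.
  by rewrite -!mulrA pe_idl y0 mulr0.
rewrite E; have [->|nz] := eqVneq (pe k i) 0; first by rewrite scaler0.
have := nz; rewrite pe_neq0 // => /andP[ki ir].
rewrite -scalerAl peM ?ki ?leqnSn // scaler_eq0.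
case/orP => [/eqP->|]; first by rewrite scale0r.
have := pe_neq0 A i.+1 kN; case: eqP => // _; have := nr k kN; lia.
Qed.

(** Each nonzero path into i then extends to a nonzero path into i+1, and the only other one is the
    trivial path at i+1. *)
Lemma coldimS : (forall k, (k <= N)%N -> reach k <> i) ->
  coldim i.+1 = (coldim i).+1.
Proof.
move=> nr; rewrite /coldim !size_filter.
have -> : iota 0 N.+1 = iota 0 i.+1 ++ i.+1 :: iota i.+2 (N - i.+1).
  transitivity (iota 0 (i.+1 + (N - i.+1).+1)); first by congr iota; lia.
  by rewrite iotaD add0n.
have s1P k : k \in iota 0 i.+1 -> (k <= i)%N by rewrite mem_iota add0n ltnS.
have s2P k : k \in iota i.+2 (N - i.+1) -> (i.+1 < k)%N.
  by rewrite mem_iota => /andP[].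
move: (iota 0 _) (iota i.+2 _) s1P s2P => s1 s2 s1P s2P.
have nz : pe i.+1 i.+1 != 0 by rewrite pe_short_neq0 ?leqnn.
have z : pe i.+1 i = 0 by rewrite pe_out //; lia.
rewrite !count_cat /= nz z eqxx /=.
rewrite !(@eq_in_count _ (fun k => pe k _ != 0) pred0 s2) ?count_pred0.
- rewrite !addn0 addn1; congr _.+1; apply: eq_in_count => k /s1P ki.
  by rewrite !pe_neq0; [have := nr k; lia | lia | lia].
- by move=> k /s2P ik; rewrite pe_out ?eqxx //; lia.
- by move=> k /s2P ik; rewrite pe_out ?eqxx //; lia.
Qed.

Lemma coldim_succ_reach : (reach i < reach i.+1)%N ->
  coldim (reach i).+1 = ((reach i).+1 - i)%N.
Proof.
move=> lt_r; have := reach_leN A i.+1; set m := (reach i).+1 => rN.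
have ri := reach_gt A iN; rewrite /coldim size_filter.
have -> : iota 0 N.+1 = iota 0 i.+1 ++ iota i.+1 (m - i) ++ iota m.+1 (N - m).
  transitivity (iota 0 (i.+1 + ((m - i) + (N - m)))); first by congr iota; lia.
  rewrite !iotaD add0n; congr (_ ++ (_ ++ iota _ _)); lia.
rewrite !count_cat (@eq_in_count _ _ pred0) ?count_pred0; last first.
  move=> k; rewrite mem_iota add0n => /andP[_ ki].
  by rewrite pe_eq0 ?eqxx //; have := @reach_mono _ _ A k i; lia.
rewrite (@eq_in_count _ _ predT) ?count_predT ?size_iota; last first.
  move=> k; rewrite mem_iota => km; rewrite pe_neq0; last lia.
  by have := @reach_mono _ _ A i.+1 k; rewrite /=; lia.
rewrite (@eq_in_count _ _ pred0) ?count_pred0 ?addn0 //.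
by move=> k; rewrite mem_iota => k2; rewrite pe_out ?eqxx //; lia.
Qed.

Lemma zb_coldim k : (zdim k + bdim k)%N = coldim (vtx k).1.
Proof. by rewrite zdim_bdim coldimE. Qed.

Lemma k_regular_simple k :
  k_regular S k <->
  [/\ (N < (vtx k.+1).1)%N, forall j, (j < k)%N -> cohom j = 0%N & cohom k = 1%N].
Proof.
have E := Ext_dimE (simple_res A iN) regA.
split=> [[[pdk _] z o]|[out z o]]; split=> //.
- exact/pd_le_simple.
- by move=> j jk; apply/E/z.
- exact/E.
- split=> [|j pdj]; first exact/pd_le_simple.
  (* A smaller projective dimension would contradict the nonvanishing of Ext in degree k. *)
  rewrite leqNgt; apply/negP => jk.
  by rewrite (pd_le_Ext (simple_res A iN) regA pdj jk) in o.
- by move=> j jk; apply/E/z.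
- exact/E.
Qed.

Lemma one_regular_simple :
  k_regular S 1 <->
  (forall k, (k <= N)%N -> reach k <> i) /\ reach i = reach i.+1.
Proof.
have mono := @reach_mono _ _ A i i.+1; have rN := reach_leN A i.+1.
rewrite k_regular_simple; split.
  case=> /= out /(_ 0%N isT); rewrite cohom0E => /ext0_eq0 nr _; split=> //.
  by move: out; rewrite /nxt iN; case: (ltnP (reach i) (reach i.+1)) => /=; lia.
case=> nr rE; have out : nxt A i i.+1 = N.+1 by rewrite /nxt rE ltnn andbF.
have z0 : zdim 0 = 0%N by apply/ext0_eq0.
have b1 : bdim 1 = 0%N by apply: bdim_out; rewrite /= out.
split=> [|[|//] _|]; first by rewrite /= out.
  by rewrite cohom0E.
(* Here [bdim 0] is dim A e_i and [zdim 1] is dim A e_{i+1}, one more. *)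
have := zb_coldim 0; have := zb_coldim 1; rewrite cohomSE z0 b1 /= coldimS //.
lia.
Qed.

Lemma two_regular_simple :
  k_regular S 2 <->
  [/\ reach i = i.+1, forall k, (k <= N)%N -> reach k <> i, (i.+2 <= N)%N
    & reach i.+1 = reach i.+2].
Proof.
have mono := @reach_mono _ _ A i i.+1; have rN := reach_leN A i.+1.
have ri := reach_gt A iN.
rewrite k_regular_simple; split.
  case=> /= out ext o.
  have := ext 0%N isT; have := ext 1%N isT.
  rewrite cohom0E cohomSE => e1 z0; move/ext0_eq0: (z0) => nr.
  (* [cohom_dim] is a truncated subtraction; these inequalities turn its vanishing into an
     equality. *)
  have b0 := bdim_le_zdim iN regA 0; have b1 := bdim_le_zdim iN regA 1.
  (* Otherwise the term of degree 2 is zero, and so is Ext^2. *)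
  have lt_r : (reach i < reach i.+1)%N.
    rewrite ltnNge; apply/negP => le; move: o.
    rewrite cohomSE; have := zb_coldim 2; rewrite /= /nxt iN (ltnNge (reach i)) le /=.
    rewrite -coldimE pe_out; last lia.
    rewrite linear0 /= lim0g dimv0; lia.
  have a2 : nxt A i i.+1 = (reach i).+1 by rewrite /nxt iN lt_r.
  move: out; rewrite a2 => out.
  have r2 : (reach (reach i).+1 <= reach i.+1)%N.
    rewrite leqNgt; apply/negP => lt; move: out; rewrite /nxt lt.
    have := reach_leN A (reach i).+1.
    by case: (leqP (reach i).+1 N) => /=; lia.
  have b2 : bdim 2 = 0%N by apply: bdim_out; rewrite /= a2.
  (* The equations give [bdim 1] = 1 and [zdim 2] = [reach i] + 1 - i. Their difference is 1, hence
     [reach i] = i + 1. *)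
  have := zb_coldim 0; have := zb_coldim 1; have := zb_coldim 2.
  rewrite /= a2 coldimS // coldim_succ_reach // z0 b2; move: o; rewrite cohomSE.
  move=> o w2 w1 w0; have rE : reach i = i.+1 by lia.
  split=> //; first lia.
  rewrite rE in r2; apply/eqP; rewrite eqn_leq r2 andbT.
  by rewrite reach_mono //; lia.
case=> rE nr i2 r12; have lt_r : (reach i < reach i.+1)%N by rewrite rE reach_gt.
have a2 : nxt A i i.+1 = i.+2 by rewrite /nxt iN lt_r rE.
have a3 : nxt A i.+1 i.+2 = N.+1 by rewrite /nxt r12 ltnn andbF.
have z0 : zdim 0 = 0%N by apply/ext0_eq0.
have b2 : bdim 2 = 0%N by apply: bdim_out; rewrite /= a2 a3.
(* As [zdim 1] + [bdim 1] = [bdim 0] + 1 and [bdim 0] <= [zdim 1], positivity forces [bdim 1] = 1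
   and the vanishing of Ext^1. The path from i+1 to i+2 is the witness. *)
have b1 : (0 < bdim 1)%N.
  rewrite lt0n dimv_eq0; apply/eqP => B0.
  have nz : pe i.+1 i.+2 != 0 by rewrite pe_short_neq0 // leqnSn.
  suff : (pe i.+1 i.+2 : regA) \in (0%VS : {vspace regA}).
    by rewrite memv0 (negPf nz).
  rewrite -B0 /= a2; apply/memv_imgP; exists (pe i.+1 i.+1); last first.
    by rewrite ract_regE pe_idl.
  by apply/memv_imgP; exists (pe i.+1 i.+1); rewrite ?memvf // ract_regE pe_idl.
have := zb_coldim 0; have := zb_coldim 1; have := zb_coldim 2.
have := coldim_succ_reach lt_r; rewrite rE /= a2 coldimS // z0 b2 => -> w2 w1 w0.
have b0 := bdim_le_zdim iN regA 0.
split=> [|[|[|//]] _|]; rewrite ?cohom0E ?cohomSE //=.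
- by rewrite a3.
- lia.
- lia.
Qed.

End Regularity.

(** * Lattice paths *)

Definition lstep : rel point := fun p q => hstep p q || vstep p q.

Lemma lstepP (p q : point) : lstep p q ->
  (q.1 = p.1 /\ q.2 = p.2 + 1) \/ (q.1 = p.1 + 1 /\ q.2 = p.2).
Proof. by case/orP => /eqP->; [left | right]. Qed.

Lemma lpath_rank p t (q : point) :
  path lstep p t -> q \in t -> p.1 + p.2 < q.1 + q.2.
Proof.
elim: t p => //= r t IHt p /andP[/lstepP pr rt]; rewrite inE => /orP[/eqP->|/IHt].
  by lia.
by move=> /(_ _ rt); lia.
Qed.

Lemma lpath_le p t (q : point) :
  path lstep p t -> q \in p :: t -> p.1 <= q.1 /\ p.2 <= q.2.
Proof.
elim: t p => [|r t IHt] p; first by rewrite inE => _ /eqP->.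
rewrite [path _ _ _]/= => /andP[/lstepP pr /IHt rt].
by rewrite inE => /orP[/eqP->|/rt] //; lia.
Qed.

Lemma lpath_le_last p t (q : point) :
  path lstep p t -> q \in p :: t ->
  q.1 <= (last p t).1 /\ q.2 <= (last p t).2.
Proof.
elim: t p q => [|r t IHt] p q; first by rewrite inE => _ /eqP->.
rewrite [path _ _ _]/= => /andP[/lstepP pr rt].
rewrite inE => /orP[/eqP->|]; last exact: IHt.
by have := IHt r r rt (mem_head _ _); rewrite /=; lia.
Qed.

(** No step decreases a coordinate, so the earlier of two points is below the other in both. Most
    later arguments exhibit two incomparable points. *)
Lemma lattice_chain s (p q : point) : lattice_path s -> p \in s -> q \in s ->
  (p.1 <= q.1 /\ p.2 <= q.2) \/ (q.1 <= p.1 /\ q.2 <= p.2).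
Proof.
elim: s => // r s IHs rs; rewrite !(inE, in_cons) => /orP[/eqP->|ps] /orP[/eqP->|qs].
- by left.
- by left; apply: (lpath_le rs); rewrite inE qs orbT.
- by right; apply: (lpath_le rs); rewrite inE ps orbT.
- exact: IHs (path_sorted rs) ps qs.
Qed.

(** The sum x + y grows by one at each step, so the first point of [m], lying on [t], can only be
    the first point of [t]. *)
Lemma lpath_prefix p t m : path lstep p t -> path lstep p m ->
  {subset m <= p :: t} -> prefix m t.
Proof.
elim: m p t => [|q m IHm] p t; first by rewrite prefix0s.
move=> pt /= /andP[pq qm] sub.
have neq (r : point) : p.1 + p.2 < r.1 + r.2 -> r == p = false.
  by move=> lt; apply/eqP => E; rewrite E ltxx in lt.
have qp : p.1 + p.2 < q.1 + q.2 by move/lstepP: pq; lia.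
have := sub q (mem_head _ _); rewrite inE neq //=.
case: t pt sub => // q' t /= /andP[pq' q't] sub; rewrite inE => /orP[/eqP qq'|qt].
  rewrite -qq' in q't sub *; rewrite eqxx; apply: IHm (q't) (qm) _ => r rm.
  have := sub r; rewrite !inE rm orbT => /(_ isT); rewrite neq //.
  by have := lpath_rank qm rm; lia.
have := lpath_rank q't qt; move/lstepP: pq; move/lstepP: pq'; lia.
Qed.

(* Consecutive points of a lattice path differ by one in x + y, so a sequence
   of steps through points of the path is a segment of it. *)
Lemma lattice_infix s m : lattice_path s -> lattice_path m ->
  infix m s <-> {subset m <= s}.
Proof.
move=> ls lm; split=> [/infixP[s1 [s2 ->]] p pm|].
  by rewrite !mem_cat pm orbT.
case: m lm => [|p m] pm sub; first exact: infix0s.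
have ps := sub p (mem_head _ _); case/splitPr: ps ls sub => s1 s2 ls sub.
have ps2 : path lstep p s2.
  by move: ls; rewrite /lattice_path -/lstep sorted_cat_cons => /andP[].
have /prefixP[s3 ->] : prefix m s2.
  apply: (lpath_prefix ps2 pm) => q qm.
  have := sub q; rewrite inE qm orbT mem_cat => /(_ isT)/orP[qs1|//].
  case/splitPr: qs1 ls => s3 s4; rewrite -catA /lattice_path -/lstep.
  rewrite sorted_cat_cons => /andP[_ qs].
  have := @lpath_rank q (s4 ++ p :: s2) p qs.
  rewrite mem_cat mem_head orbT => /(_ isT).
  by have := lpath_rank pm qm; lia.
by apply/infixP; exists s1, s3.
Qed.

(** A discrete intermediate value argument: the step at which x first exceeds k is vertical and
    starts in column k. *)
Lemma lpath_vcross p t (k : int) : path lstep p t -> p.1 <= k < (last p t).1 ->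
  exists y, (k, y) \in p :: t /\ (k + 1, y) \in p :: t.
Proof.
elim: t p => [|q t IHt] p; first by rewrite /=; lia.
rewrite [path _ _ _]/= [last _ _]/= => /andP[/lstepP pq qt] kb.
have [le_qk|lt_kq] := lerP q.1 k.
  have [|y [y1 y2]] := IHt _ qt; first by lia.
  by exists y; rewrite inE y1 orbT inE y2 orbT.
exists p.2; rewrite !inE; split.
  by rewrite (_ : (k, p.2) = p) ?eqxx // [RHS]surjective_pairing; congr pair; lia.
rewrite (_ : (k + 1, p.2) = q) ?eqxx ?orbT // [RHS]surjective_pairing.
by congr pair; lia.
Qed.

Lemma lpath_hcross p t (k : int) : path lstep p t -> p.2 <= k < (last p t).2 ->
  exists x, (x, k) \in p :: t /\ (x, k + 1) \in p :: t.
Proof.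
elim: t p => [|q t IHt] p; first by rewrite /=; lia.
rewrite [path _ _ _]/= [last _ _]/= => /andP[/lstepP pq qt] kb.
have [le_qk|lt_kq] := lerP q.2 k.
  have [|y [y1 y2]] := IHt _ qt; first by lia.
  by exists y; rewrite inE y1 orbT inE y2 orbT.
exists p.1; rewrite !inE; split.
  by rewrite (_ : (p.1, k) = p) ?eqxx // [RHS]surjective_pairing; congr pair; lia.
rewrite (_ : (p.1, k + 1) = q) ?eqxx ?orbT // [RHS]surjective_pairing.
by congr pair; lia.
Qed.

(** * The extended Dyck path and its height function *)

Section DyckPath.
Variables (N : nat) (D : seq point) (r : nat -> nat).
Hypothesis dyckD : is_dyck N D.
Hypothesis heightD : forall k, (k <= N)%N -> height D k = (r k)%:Z.
Local Notation s := (extend_path N D).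

Lemma extend_lpath : path lstep (0, -1) (rcons D (N.+1%:Z, N%:Z)).
Proof.
have [t [-> lt lD _]] := dyckD; rewrite rcons_path /=.
apply/andP; split; first exact: lD.
rewrite lt; apply/orP; right; apply/eqP; congr pair => /=; lia.
Qed.

Lemma extend_lattice : lattice_path s.
Proof. exact: extend_lpath. Qed.

Lemma extend_last : last (0, -1) (rcons D (N.+1%:Z, N%:Z)) = (N.+1%:Z, N%:Z).
Proof. by rewrite last_rcons. Qed.

Lemma mem_extend p : p \in D -> p \in s.
Proof. by move=> pD; rewrite inE mem_rcons inE pD !orbT. Qed.

(** The path leaves column k by a vertical step. Its height is the maximum of the column, since
    every point there is comparable with the end of that step. *)
Lemma extend_vcross k : (k <= N)%N ->
  (k%:Z, (r k)%:Z) \in s /\ (k%:Z + 1, (r k)%:Z) \in s.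
Proof.
move=> kN; have [|y [y1 y2]] := lpath_vcross (k := k%:Z) extend_lpath.
  by rewrite extend_last /=; lia.
rewrite -/s in y1 y2; suff -> : (r k)%:Z = y by [].
have D0 : (0, 0) \in D by have [t [-> _ _ _]] := dyckD; rewrite mem_head.
have chain := lattice_chain extend_lattice.
(* The step starts at no added point: after (0, -1) it would end at (1, -1), incomparable with (0,
   0), and (N+1, N) is beyond column k. *)
have yD : (k%:Z, y) \in D.
  move: (y1); rewrite inE mem_rcons inE => /or3P[/eqP[k0 ym]|/eqP[kN1 _]|//].
    by have := chain _ _ (mem_extend D0) y2; rewrite /=; lia.
  lia.
(* The maximum defining [height] has default value 0, so bounding it by [y] requires this. *)
have y0 : 0 <= y.
  have [t [Dt _ lD _]] := dyckD; rewrite Dt in yD lD.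
  by have := lpath_le lD yD => /=; lia.
rewrite -heightD // /height; apply/eqP; rewrite eq_le; apply/andP; split.
  rewrite big_seq_cond; apply: bigmax_le => // p /andP[pD /eqP pk].
  by have := chain _ _ (mem_extend pD) y2; rewrite /=; lia.
exact: (@le_bigmax_seq _ _ _ _ _ (k%:Z, y)).
Qed.

Lemma extend_vstep k y : (k <= N)%N ->
  (k%:Z, y) \in s -> (k%:Z + 1, y) \in s -> y = (r k)%:Z.
Proof.
move=> /extend_vcross[r1 r2] y1 y2; have chain := lattice_chain extend_lattice.
by have := chain _ _ r1 y2; have := chain _ _ y1 r2; rewrite /=; lia.
Qed.

Lemma extend_vstep_to k : (k <= N)%N ->
  vstep_to s (k%:Z + 1) (k%:Z + 1) <-> r k = k.+1.
Proof.
move=> kN; rewrite /vstep_to lattice_infix ?addrK; last 2 first.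
- exact: extend_lattice.
- by rewrite /= andbT /vstep eqxx orbT.
split=> [sub|rk].
  have := extend_vstep kN (sub _ (mem_head _ _)) (sub _ (mem_last _ _)); lia.
have [r1 r2] := extend_vcross kN; move=> p; rewrite !inE.
have E : (r k)%:Z = k%:Z + 1 by lia.
by rewrite E in r1 r2; case/orP => /eqP->.
Qed.

(** The two steps leave columns k and k+1 at a common height, and each column is left at one height
    only. The path ends in column N+1, whence k < N. *)
Lemma extend_double_fall k : (k <= N)%N ->
  (exists y, double_fall s (k%:Z + 1) y) <-> (k < N)%N /\ r k = r k.+1.
Proof.
move=> kN; have lat y : lattice_path
    [:: (k%:Z + 1 - 1, y); (k%:Z + 1, y); (k%:Z + 1 + 1, y)].
  by rewrite /= /vstep /= addrK !eqxx !orbT.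
split=> [[y]|[lt_kN rk]].
  rewrite /double_fall (lattice_infix extend_lattice (lat y)) addrK => sub.
  have y0 : (k%:Z, y) \in s by apply: sub; rewrite mem_head.
  have y1 : (k%:Z + 1, y) \in s by apply: sub; rewrite !inE eqxx orbT.
  have y2 : (k%:Z + 1 + 1, y) \in s by apply: sub; rewrite !inE eqxx !orbT.
  have := lpath_le_last extend_lpath y2; rewrite extend_last /= => bnd.
  have lt_kN : (k < N)%N by lia.
  split=> //; have := extend_vstep kN y0 y1.
  have kS : k%:Z + 1 = k.+1%:Z by lia.
  by rewrite kS in y1 y2; have := extend_vstep lt_kN y1 y2; lia.
exists (r k)%:Z.
rewrite /double_fall (lattice_infix extend_lattice (lat _)) addrK => p.
have [r0 r1] := extend_vcross kN; have [_ r2] := extend_vcross lt_kN.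
have kS : k.+1%:Z = k%:Z + 1 by lia.
by rewrite kS -rk in r2; rewrite !inE => /or3P[] /eqP->.
Qed.

(** A vertical step at height i would contain a point incomparable with an end of the double rise.
    Conversely, without such a step the path enters and leaves height i in the same column. *)
Lemma extend_double_rise i : (i < N)%N ->
  (exists x, double_rise s x i%:Z) <-> (forall k, (k <= N)%N -> r k <> i).
Proof.
move=> iN; have chain := lattice_chain extend_lattice.
have lat x : lattice_path [:: (x, i%:Z - 1); (x, i%:Z); (x, i%:Z + 1)].
  by rewrite /= /hstep /= subrK !eqxx.
split=> [[x]|nr].
  rewrite /double_rise (lattice_infix extend_lattice (lat x)) => sub k kN ki.
  have x0 : (x, i%:Z - 1) \in s by apply: sub; rewrite mem_head.
  have x2 : (x, i%:Z + 1) \in s by apply: sub; rewrite !inE eqxx !orbT.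
  have [r1 r2] := extend_vcross kN; rewrite ki in r1 r2.
  by have := chain _ _ x0 r1; have := chain _ _ x2 r2; rewrite /=; lia.
(* The prepended step makes this crossing exist for i = 0 too. *)
have [|x [x1 x2]] := lpath_hcross (k := i%:Z - 1) extend_lpath.
  by rewrite extend_last /=; lia.
have [|x' [x1' x2']] := lpath_hcross (k := i%:Z) extend_lpath.
  by rewrite extend_last /=; lia.
rewrite -/s in x1 x2 x1' x2'; rewrite subrK in x2.
have le0x := lpath_le extend_lpath x1; have le_x'N := lpath_le_last extend_lpath x2'.
rewrite extend_last /= in le0x le_x'N.
suff xx' : x' = x.
  exists x; rewrite /double_rise (lattice_infix extend_lattice (lat x)) => p.
  by rewrite !inE xx' in x2' *; case/or3P => /eqP->.
apply/eqP; rewrite eq_le; apply/andP; split; last first.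
  by have := chain _ _ x1 x1'; rewrite /=; lia.
rewrite leNgt; apply/negP => lt_xx'.
(* The path then leaves column x by a vertical step at height i. *)
pose k := `|x|%N; have kx : k%:Z = x by lia.
have kN : (k <= N)%N by lia.
apply: (nr k kN); have [r1 r2] := extend_vcross kN; rewrite kx in r1 r2.
by have := chain _ _ r1 x1'; have := chain _ _ r2 x2; rewrite /=; lia.
Qed.

End DyckPath.

Theorem theorem3p8 (F : fieldType) (N : nat) (A : LNakayama F N)
    (D : seq point) (hD : is_dyck_path_of A D)
    (i : 'I_N.+1) (hi : (i < N)%N) :
  (k_regular (simple_at A i) 1 <->
     (exists x : int, double_rise (extend_path N D) x i%:Z) /\
     (exists y : int, double_fall (extend_path N D) (i%:Z + 1) y))
  /\
  (k_regular (simple_at A i) 2 <->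
     [/\ vstep_to (extend_path N D) (i%:Z + 1) (i%:Z + 1),
         exists x : int, double_rise (extend_path N D) x i%:Z
       & exists y : int, double_fall (extend_path N D) (i%:Z + 2) y]).
Proof.
have [dyckD areaD] := hD.
(* Both [area] and [kupisch] count from k up to the top of the column, so the tops agree. *)
have heightD k : (k <= N)%N -> height D k = (reach A k)%:Z.
  move=> kN; have := areaD (Ordinal (kN : (k < N.+1)%N)).
  by rewrite /area kupischE /=; have := reach_ge A kN; lia.
have rise := extend_double_rise dyckD heightD hi.
have fall := extend_double_fall dyckD heightD.
split; [rewrite one_regular_simple // | rewrite two_regular_simple //].
  have fall_i := fall _ (ltnW hi); split.
    by case=> nr ri; split; [apply/rise | apply/fall_i].
  by case=> /rise nr /fall_i[_ ri].
(* A double fall at i+2 compares columns i+1 and i+2, so the criterion is used at i+1. *)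
have -> : i%:Z + 2 = i.+1%:Z + 1 by lia.
have vert := extend_vstep_to dyckD heightD (ltnW hi).
have fall_i := fall _ hi; split.
  by case=> ri nr i2N r2; split; [apply/vert | apply/rise | apply/fall_i].
by case=> /vert ri /rise nr /fall_i[i2N r2]; split.
Qed.
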